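(* Let $A\in\mathbb{R}^{m\times n}$ ($m<n$) and $M\in\mathbb{R}^{m\times q}$ ($m\le q$) with $\mathrm{rank}(A)=\mathrm{rank}(M)=m$, and let $y\in\mathbb{R}^m$, $\tau\ge 0$, $\alpha\in[0,1]$ be given. Consider the problem $$(\mathrm{P})\qquad \min_{x}\{\|x\|_1:\ \alpha\|M^T(Ax-y)\|_\infty+(1-\alpha)\|M^T(Ax-y)\|_1\le\tau\}.$$ Suppose that $A^T$ satisfies the weak RSP of order $k$. Then for any $x\in\mathbb{R}^n$ there is an optimal solution $x^*$ of $(\mathrm{P})$ with $$\|x-x^*\|_2\le\gamma\left\{\left(\alpha\|\vartheta\|_\infty+(1-\alpha)\|\vartheta\|_1-\tau\right)^++2\sigma_k(x)_1+c(\tau+\|\vartheta\|_\infty)\right\},$$ where $\vartheta=M^T(Ax-y)$, $$c=\max_{G\subseteq\{1,\dots,q\},\,|G|=m}\{\|M_G^{-1}(AA^T)^{-1}A\|_{\infty\to1}:\ M_G\in\mathbb{R}^{m\times m}\text{ is an invertible submatrix of }M\},$$ and $\gamma=\sigma_{\infty,2}(M^1,M^2)$ is the Robinson's constant of the pair $(M^1,M^2)$ defined in the context. In particular, for any $x$ satisfying the constraint of $(\mathrm{P})$ there is an optimal solution $x^*$ of $(\mathrm{P})$ with $$\|x-x^*\|_2\le\gamma\{2\sigma_k(x)_1+c\tau+c\|M^T(Ax-y)\|_\infty\}\le2\gamma\{\sigma_k(x)_1+c\tau\}.$$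
   Context: Notation: $(s)^+=\max\{s,0\}$; $\sigma_k(x)_1=\inf_u\{\|x-u\|_1:\|u\|_0\le k\}$, where $\|u\|_0$ is the number of nonzero entries; $M_G$ is the submatrix of $M$ consisting of columns indexed by $G$; $\|Q\|_{\infty\to1}=\max_{\|x\|_\infty\le1}\|Qx\|_1$. Weak RSP of order $k$ of $A^T$: for any disjoint $S_1,S_2\subseteq\{1,\dots,n\}$ with $|S_1|+|S_2|\le k$ there exists $\zeta\in\mathcal{R}(A^T)$ (the range of $A^T$) with $\zeta_i=1$ for $i\in S_1$, $\zeta_i=-1$ for $i\in S_2$, and $|\zeta_i|\le1$ for $i\notin S_1\cup S_2$. Robinson's constant: for $M'\in\mathbb{R}^{p_1\times r}$, $M''\in\mathbb{R}^{p_2\times r}$ let $$\mu_{\alpha_1,\alpha_2}(M',M'')=\max_{(d',d'')\in\mathcal F,\ \|(d',d'')\|_{\alpha_2}\le1}\ \min_{u\in\mathbb{R}^r}\{\|u\|_{\alpha_1}:\ M'u\le d',\ M''u=d''\},$$ with $\mathcal F=\{(d',d''):\ M'u\le d',\ M''u=d''\text{ for some }u\in\mathbb{R}^r\}$ (this is a finite number). For $N^1\in\mathbb{R}^{m_1\times\ell}$, $N^2\in\mathbb{R}^{m_2\times\ell}$, $$\sigma_{\alpha_1,\alpha_2}(N^1,N^2)=\max_{S\subseteq\{1,\dots,m_1\}}\mu_{\alpha_1,\alpha_2}\left(\begin{bmatrix}I_S&0\\-I&0\end{bmatrix},\begin{bmatrix}N^1\\N^2\end{bmatrix}^T\right),$$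 where $I$ is the $m_1\times m_1$ identity, $I_S$ consists of the rows of $I$ indexed by $S$, and the first matrix has $m_1+m_2$ columns. The matrices $M^1,M^2$: let $\mathbf e\in\mathbb{R}^q$ and $\widetilde{\mathbf e}\in\mathbb{R}^n$ be vectors of ones. The block columns have sizes $n,n,1,q,n,n,1,q,q,q,q$ (corresponding to variables $(x,t,\xi,v,w^{(1)},\dots,w^{(7)})$), $I$ and $0$ being identity and zero blocks of suitable sizes: $$M^1=\begin{bmatrix} I&-I&0&0&0&0&0&0&0&0&0\\ -I&-I&0&0&0&0&0&0&0&0&0\\ 0&0&\alpha&(1-\alpha)\mathbf e^T&0&0&0&0&0&0&0\\ M^TA&0&-\mathbf e&0&0&0&0&0&0&0&0\\ -M^TA&0&-\mathbf e&0&0&0&0&0&0&0&0\\ M^TA&0&0&-I&0&0&0&0&0&0&0\\ -M^TA&0&0&-I&0&0&0&0&0&0&0\\ 0&0&0&0&I&I&0&0&0&0&0\\ 0&0&0&0&0&0&-\alpha&\mathbf e^T&\mathbf e^T&0&0\\ 0&0&0&0&0&0&-(1-\alpha)\mathbf e&0&0&I&I\\ 0&0&0&0&-I&0&0&0&0&0&0\\ 0&0&0&0&0&-I&0&0&0&0&0\\ 0&0&0&0&0&0&-1&0&0&0&0\\ 0&0&0&0&0&0&0&-I&0&0&0\\ 0&0&0&0&0&0&0&0&-I&0&0\\ 0&0&0&0&0&0&0&0&0&-I&0\\ 0&0&0&0&0&0&0&0&0&0&-I \end{bmatrix},$$ $$M^2=\begin{bmatrix} 0&0&0&0&-I&I&0&A^TM&-A^TM&-A^TM&A^TM\\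 0&\widetilde{\mathbf e}^T&0&0&0&0&\tau&-y^TM&y^TM&y^TM&-y^TM \end{bmatrix}.$$ *)

(* Defs.v *)
From HB Require Import structures.
From mathcomp Require Export all_boot all_order all_algebra.
From mathcomp Require Export classical_sets reals matrix_normedtype.

Set Implicit Arguments.
Unset Strict Implicit.
Unset Printing Implicit Defensive.

Import Order.TTheory GRing.Theory Num.Theory.
Local Open Scope ring_scope.
Local Open Scope classical_set_scope.

(* Every maximum (minimum) over a possibly infinite set of reals is written
   with [sup] ([inf]).  These return 0 on a set that is empty or unbounded
   above (below); all the sets below are nonempty and bounded on the relevant
   side, so that the default value does not occur. *)

Section Norms.
Context {R : realType}.

Definition l1norm (n : nat) (x : 'cV[R]_n) : R := \sum_i `|x i 0|.

Definition l2norm (n : nat) (x : 'cV[R]_n) : R :=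
  Num.sqrt (\sum_i x i 0 ^+ 2).

(* [mx_norm] is the largest absolute value of an entry. *)
Definition linfnorm (n : nat) (x : 'cV[R]_n) : R := mx_norm x.

Definition l0norm (n : nat) (x : 'cV[R]_n) : nat := #|[set i | x i 0 != 0]%SET|.

Definition pos_part (s : R) : R := Num.max s 0.

Definition sigma1 (k n : nat) (x : 'cV[R]_n) : R :=
  inf [set l1norm (x - u) | u in [set u : 'cV[R]_n | (l0norm u <= k)%N]].

Definition norm_inf_to_1 (p r : nat) (Q : 'M[R]_(p, r)) : R :=
  sup [set l1norm (Q *m x) | x in [set x : 'cV[R]_r | linfnorm x <= 1]].

End Norms.

Section WeakRSP.
Context {R : realType}.

(* To be used with B = A^T. *)
Definition weak_RSP (n m : nat) (B : 'M[R]_(n, m)) (k : nat) : Prop :=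
  forall S1 S2 : {set 'I_n}, [disjoint S1 & S2]%B -> (#|S1| + #|S2| <= k)%N ->
  exists zeta : 'cV[R]_n,
    [/\ exists u : 'cV[R]_m, zeta = B *m u,
        forall i, i \in S1 -> zeta i 0 = 1,
        forall i, i \in S2 -> zeta i 0 = -1 &
        forall i, i \notin S1 :|: S2 -> `|zeta i 0| <= 1].

End WeakRSP.

Section RobinsonConstant.
Context {R : realType}.

(* The two norm indices are represented by families of norms, one norm for
   each dimension. *)
Variables (nrm1 nrm2 : forall r : nat, 'cV[R]_r -> R).

Definition lin_system (p1 p2 r : nat) (M' : 'M[R]_(p1, r)) (M'' : 'M[R]_(p2, r))
    (d' : 'cV[R]_p1) (d'' : 'cV[R]_p2) : set 'cV[R]_r :=
  [set u | (forall i, (M' *m u) i 0 <= d' i 0) /\ M'' *m u = d''].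

Definition robinson_mu (p1 p2 r : nat)
    (M' : 'M[R]_(p1, r)) (M'' : 'M[R]_(p2, r)) : R :=
  sup [set inf [set nrm1 u | u in lin_system M' M'' d.1 d.2]
      | d in [set d : 'cV[R]_p1 * 'cV[R]_p2 |
                lin_system M' M'' d.1 d.2 !=set0 /\
                nrm2 (col_mx d.1 d.2) <= 1]].

Definition rows_of_id (m1 : nat) (S : {set 'I_m1}) : 'M[R]_(#|S|, m1) :=
  rowsub (fun i : 'I_#|S| => enum_val i) 1%:M.

(* The values of [robinson_mu] are nonnegative when [nrm1] is a norm, so that
   starting the maximum at 0 has no effect. *)
Definition robinson_sigma (m1 m2 l : nat)
    (N1 : 'M[R]_(m1, l)) (N2 : 'M[R]_(m2, l)) : R :=
  \big[Num.max/0]_(S : {set 'I_m1})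
    robinson_mu (block_mx (rows_of_id S) (0 : 'M_(#|S|, m2))
                          (- 1%:M)       (0 : 'M_(m1, m2)))
                (col_mx N1 N2)^T.

End RobinsonConstant.

Section Problem.
Context {R : realType}.
Variables (m n q : nat) (A : 'M[R]_(m, n)) (M : 'M[R]_(m, q)) (y : 'cV[R]_m).
Variables (tau alpha : R).

Definition residual (x : 'cV[R]_n) : 'cV[R]_q := M^T *m (A *m x - y).

Definition feasibleP (x : 'cV[R]_n) : Prop :=
  alpha * linfnorm (residual x) + (1 - alpha) * l1norm (residual x) <= tau.

Definition optimalP (x : 'cV[R]_n) : Prop :=
  feasibleP x /\ forall z, feasibleP z -> l1norm x <= l1norm z.

Definition col_submx (G : {set 'I_q}) (cardG : #|G| = m) : 'M[R]_m :=
  castmx (erefl m, cardG) (colsub (fun j : 'I_#|G| => enum_val j) M).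

Definition const_c : R :=
  sup [set v | exists (G : {set 'I_q}) (cardG : #|G| = m),
         col_submx cardG \in unitmx /\
         v = norm_inf_to_1
               (invmx (col_submx cardG) *m invmx (A *m A^T) *m A)].

(* One row of blocks; the columns are those of the variables
   (x, t, xi, v, w1, ..., w7). *)
Definition block_row (p : nat)
    (Bx Bt : 'M[R]_(p, n)) (Bxi : 'M[R]_(p, 1)) (Bv : 'M[R]_(p, q))
    (B1 B2 : 'M[R]_(p, n)) (B3 : 'M[R]_(p, 1))
    (B4 B5 B6 B7 : 'M[R]_(p, q)) :=
  row_mx Bx (row_mx Bt (row_mx Bxi (row_mx Bv (row_mx B1 (row_mx B2
  (row_mx B3 (row_mx B4 (row_mx B5 (row_mx B6 B7))))))))).

Local Notation I := (1%:M).
Local Notation e := (const_mx 1 : 'cV[R]_q).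
Local Notation eT := (const_mx 1 : 'rV[R]_q).
Local Notation etT := (const_mx 1 : 'rV[R]_n).
Local Notation a := (alpha%:M : 'M[R]_1).
Local Notation MtA := (M^T *m A).
Local Notation AtM := (A^T *m M).
Local Notation ytM := (y^T *m M).

(* [matM1] and [matM2] are the coefficients of the inequalities and equations
   that characterize the optimal primal-dual pairs of the linear program
     min sum_i t_i  s.t.  |x| <= t,  alpha xi + (1 - alpha) e^T v <= tau,
                          |M^T (A x - y)| <= xi e,  |M^T (A x - y)| <= v,
   in which w1, ..., w7 >= 0 are the dual variables; the last row of [matM2]
   is the equality of the two objective values. *)
Definition matM1 :=
  col_mx (@block_row n I (- I) 0 0 0 0 0 0 0 0 0) (
  col_mx (@block_row n (- I) (- I) 0 0 0 0 0 0 0 0 0) (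
  col_mx (@block_row 1 0 0 a ((1 - alpha) *: eT) 0 0 0 0 0 0 0) (
  col_mx (@block_row q MtA 0 (- e) 0 0 0 0 0 0 0 0) (
  col_mx (@block_row q (- MtA) 0 (- e) 0 0 0 0 0 0 0 0) (
  col_mx (@block_row q MtA 0 0 (- I) 0 0 0 0 0 0 0) (
  col_mx (@block_row q (- MtA) 0 0 (- I) 0 0 0 0 0 0 0) (
  col_mx (@block_row n 0 0 0 0 I I 0 0 0 0 0) (
  col_mx (@block_row 1 0 0 0 0 0 0 (- a) eT eT 0 0) (
  col_mx (@block_row q 0 0 0 0 0 0 (- ((1 - alpha) *: e)) 0 0 I I) (
  col_mx (@block_row n 0 0 0 0 (- I) 0 0 0 0 0 0) (
  col_mx (@block_row n 0 0 0 0 0 (- I) 0 0 0 0 0) (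
  col_mx (@block_row 1 0 0 0 0 0 0 (- I) 0 0 0 0) (
  col_mx (@block_row q 0 0 0 0 0 0 0 (- I) 0 0 0) (
  col_mx (@block_row q 0 0 0 0 0 0 0 0 (- I) 0 0) (
  col_mx (@block_row q 0 0 0 0 0 0 0 0 0 (- I) 0)
         (@block_row q 0 0 0 0 0 0 0 0 0 0 (- I))))))))))))))))).

Definition matM2 :=
  col_mx (@block_row n 0 0 0 0 (- I) I 0 AtM (- AtM) (- AtM) AtM)
         (@block_row 1 0 etT 0 0 0 0 tau%:M (- ytM) ytM ytM (- ytM)).

Definition const_gamma : R :=
  robinson_sigma (@linfnorm R) (@l2norm R) matM1 matM2.

End Problem.

(* Main.v *)
(* By Robinson's bound, the distance from a point to a nonempty polyhedron
   [N1 z <= b1, N2 z = b2] is at most [robinson_sigma N1 N2] times the l1 norm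
   of the residual of the point. The polyhedron of [matM1] and [matM2] consists
   of the optimal primal-dual pairs of the linear program equivalent to (P), so
   it remains to complete the given x to a primal-dual point of small residual.
   The primal part is [|x|, linfnorm theta, |theta|]. For the dual part, the
   weak RSP yields [zeta] in the range of [A^T] that agrees with the signs of x
   on its k largest entries; writing [zeta = A^T M h] with [l1norm h <= c] and
   splitting [zeta] and [h] into positive and negative parts gives a feasible
   dual point with [w3 = l1norm h]. The residual then lies in the budget
   constraint and in the duality gap only, and the gap is at most
   [2 sigma1 k x + c (tau + linfnorm theta)]. *)

Require Import Defs.
From mathcomp Require Import all_boot all_order all_algebra.
From mathcomp Require Import boolp classical_sets reals matrix_normedtype.
From mathcomp Require Import ring lra.

Import Order.TTheory GRing.Theory Num.Theory.
Local Open Scope ring_scope.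

Set Implicit Arguments.
Unset Strict Implicit.
Unset Printing Implicit Defensive.

(** * Farkas' lemma *)

Section LinearInequalities.
Context {R : realFieldType}.

Definition lev (p : nat) (u v : 'cV[R]_p) := forall i, u i 0 <= v i 0.

Lemma lev_refl p (u : 'cV[R]_p) : lev u u.
Proof. by move=> i. Qed.

Lemma lev_col_mx p1 p2 (u1 v1 : 'cV[R]_p1) (u2 v2 : 'cV[R]_p2) :
  lev (col_mx u1 u2) (col_mx v1 v2) <-> lev u1 v1 /\ lev u2 v2.
Proof.
split=> [le_uv|[le1 le2] i].
  split=> i; first by have := le_uv (lshift _ i); rewrite !col_mxEu.
  by have := le_uv (rshift _ i); rewrite !col_mxEd.
by case: (split_ordP i) => j ->; rewrite ?col_mxEu ?col_mxEd.
Qed.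

Lemma lev_col_mx0 p1 p2 (u1 : 'cV[R]_p1) (u2 : 'cV[R]_p2) :
  lev (col_mx u1 u2) 0 <-> lev u1 0 /\ lev u2 0.
Proof.
rewrite -[X in lev _ X](@vsubmxK _ p1 p2) linear0 linear0.
exact: lev_col_mx.
Qed.

Lemma levN p (u v : 'cV[R]_p) : lev (- u) (- v) <-> lev v u.
Proof. by split=> h i; have := h i; rewrite !mxE lerN2. Qed.

Lemma ler_mulmx11 p (u : 'rV[R]_p) (v w : 'cV[R]_p) :
  (forall i, 0 <= u 0 i) -> lev v w -> (u *m v) 0 0 <= (u *m w) 0 0.
Proof.
move=> u0 vw; rewrite !mxE; apply: ler_sum => i _.
exact: ler_wpM2l.
Qed.

(* Bartl's induction on the number of rows: if [x] separates [c] from the cone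
   of the rows of [B] but [a *m x = 1], eliminate [a] along [x]. *)
Lemma farkas p r (B : 'M[R]_(p, r)) (c : 'rV[R]_r) :
  (exists2 l : 'rV[R]_p, (forall i, 0 <= l 0 i) & c = l *m B) \/
  (exists2 w : 'cV[R]_r, lev (B *m w) 0 & 0 < (c *m w) 0 0).
Proof.
elim: p => [|p IHp] in B c *.
  have [->|nz_c] := eqVneq c 0.
    by left; exists 0 => [[]|] //; rewrite mul0mx.
  right; exists c^T => [[]|] //.
  have [j nz_j] : exists j, c 0 j != 0.
    by apply/rV0Pn.
  rewrite mxE (bigD1 j) //= mxE ltr_pwDl //.
    by rewrite -expr2 lt0r sqrf_eq0 nz_j sqr_ge0.
  by apply: sumr_ge0 => i _; rewrite mxE -expr2 sqr_ge0.
move: B; rewrite -(add1n p) => B; rewrite -(vsubmxK B).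
set a := usubmx B; set B' := dsubmx B.
have cons_ge0 (s : R) (l : 'rV[R]_p) : 0 <= s -> (forall i, 0 <= l 0 i) ->
    forall i, 0 <= row_mx (s%:M : 'M_1) l 0 i.
  move=> s0 l0 i; case: (split_ordP i) => j ->.
    by rewrite row_mxEl !ord1 mxE eqxx.
  by rewrite row_mxEr.
have [[l l0 ->]|[x Bx cx]] := IHp B' c.
  left; exists (row_mx (0%:M : 'M_1) l); first exact: cons_ge0.
  by rewrite mul_row_col mul_scalar_mx scale0r add0r.
have [ax0|ax0] := leP ((a *m x) 0 0) 0.
  right; exists x => //; rewrite mul_col_mx.
  by apply/lev_col_mx0; split=> // i; rewrite !ord1 [leRHS]mxE.
have [{Bx cx ax0}x [Bx cx ax1]] : exists x,
    [/\ lev (B' *m x) 0, 0 < (c *m x) 0 0 & a *m x = 1%:M].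
  exists (((a *m x) 0 0)^-1 *: x); split.
  - by move=> i; rewrite -scalemxAr mxE [leRHS]mxE pmulr_rle0 ?invr_gt0 //;
      apply: le_trans (Bx i) _; rewrite mxE.
  - by rewrite -scalemxAr mxE mulr_gt0 ?invr_gt0.
  - by apply/matrixP=> i j; rewrite -scalemxAr !ord1 mxE mulVf ?gt_eqF // mxE.
have [[l l0 cl]|[w Bw cw]] := IHp (B' - B' *m x *m a) (c - c *m x *m a).
  (* The multiplier of [a] that undoes the elimination is nonnegative because
     [B' *m x <= 0 < c *m x] and [l >= 0]. *)
  left; exists (row_mx ((c *m x - l *m B' *m x) 0 0)%:M l).
    apply: cons_ge0 => //; rewrite mxE [X in _ + X]mxE subr_ge0.
    apply: le_trans (ltW cx).
    by have := ler_mulmx11 l0 Bx; rewrite mulmx0 mulmxA [leRHS]mxE.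
  rewrite mul_row_col -mx11_scalar mulmxBl -[LHS](subrK (c *m x *m a)) cl.
  by rewrite mulmxBr !mulmxA [RHS]addrC addrAC addrA.
(* Correcting [w] along [x] makes the row [a] vanish, since [a *m x = 1]. *)
right; exists (w - x *m (a *m w)).
  rewrite mul_col_mx; apply/lev_col_mx0; split=> i.
    by rewrite mulmxBr (mulmxA a x) ax1 mul1mx subrr !mxE.
  by have := Bw i; rewrite mulmxBl mulmxBr !mulmxA.
by move: cw; rewrite mulmxBl mulmxBr !mulmxA.
Qed.

End LinearInequalities.

(** * Strong duality of linear programming *)

Section LinearProgramming.
Context {R : realFieldType}.

(** Homogenize with one more variable [s]: [farkas] is applied to [B u - s d <= 0], [- s <= 0] and
    the objective [s]. A separating point has [s > 0] and is divided by [s]; otherwise the last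
    coordinate of the combination reads [l d = -1 - (multiplier of - s <= 0)]. *)
Lemma affine_farkas p r (B : 'M[R]_(p, r)) (d : 'cV[R]_p) :
  (exists u, lev (B *m u) d) \/
  (exists2 l : 'rV[R]_p, (forall i, 0 <= l 0 i) &
     l *m B = 0 /\ (l *m d) 0 0 < 0).
Proof.
case: (farkas (col_mx (row_mx B (- d)) (row_mx 0 (- 1%:M)))
              (row_mx 0 1%:M : 'rV_(r + 1))) => [[l l0]|[w]].
  rewrite -(hsubmxK l) mul_row_col !mul_mx_row add_row_mx => /eq_row_mx[].
  rewrite mulmx0 addr0 => lB ld; right; exists (lsubmx l).
    by move=> i; rewrite mxE.
  split=> //; have := congr1 (fun C : 'M_1 => C 0 0) ld.
  rewrite !mulmxN mulmx1 mxE [RHS]mxE [X in _ = X + _]mxE.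
  have -> : (- rsubmx l) 0 0 = - l 0 (rshift _ 0) by rewrite !mxE.
  by have := l0 (rshift _ 0); rewrite eqxx /=; lra.
rewrite -(vsubmxK w) mul_col_mx !mul_row_col !mul0mx !mulNmx !mul1mx !add0r.
set u := usubmx w; set s := dsubmx w => /lev_col_mx0[Bu _] s0.
left; exists ((s 0 0)^-1 *: u) => i; rewrite -scalemxAr mxE.
rewrite ler_pdivrMl //; have := Bu i;
  rewrite [leRHS]mxE mxE [X in _ + X]mxE subr_le0.
by rewrite {1}(mx11_scalar s) mul_mx_scalar [(_ *: d) i 0]mxE.
Qed.

Lemma mulmx11_tr p (u : 'rV[R]_p) (v : 'cV[R]_p) :
  (u *m v) 0 0 = (v^T *m u^T) 0 0.
Proof. by rewrite -trmx_mul [RHS]mxE. Qed.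

Lemma row_mx_ge0 p1 p2 (u : 'rV[R]_p1) (v : 'rV[R]_p2) :
  (forall i, 0 <= row_mx u v 0 i) <->
  (forall i, 0 <= u 0 i) /\ (forall i, 0 <= v 0 i).
Proof.
split=> [uv0|[u0 v0] i].
  split=> i; first by have := uv0 (lshift _ i); rewrite row_mxEl.
  by have := uv0 (rshift _ i); rewrite row_mxEr.
by case: (split_ordP i) => j ->; rewrite ?row_mxEl ?row_mxEr.
Qed.

(* A Farkas certificate [(l1, nm - np, kappa)] against the joint system of
   primal feasibility, dual feasibility and no duality gap is, after division
   by [kappa], a pair violating weak duality, and, if [kappa = 0], a direction
   contradicting the feasibility of [u0] or [w0]. *)
Lemma lp_strong_duality p r (B : 'M[R]_(p, r)) (b : 'cV[R]_p) (c : 'rV[R]_r)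
    (u0 : 'cV[R]_r) (w0 : 'rV[R]_p) :
  lev (B *m u0) b -> (forall i, 0 <= w0 0 i) -> w0 *m B = - c ->
  exists (u : 'cV[R]_r) (w : 'rV[R]_p),
    [/\ lev (B *m u) b, (forall i, 0 <= w 0 i), w *m B = - c &
        (c *m u) 0 0 + (w *m b) 0 0 <= 0].
Proof.
move=> Bu0 w0_ge0 w0B.
have [[z]|[l]] := affine_farkas
    (col_mx (row_mx B 0) (col_mx (row_mx 0 (- 1%:M)) (col_mx (row_mx 0 B^T)
      (col_mx (row_mx 0 (- B^T)) (row_mx c b^T)))))
    (col_mx b (col_mx 0 (col_mx (- c^T) (col_mx c^T 0)))).
  rewrite -(vsubmxK z) !mul_col_mx !mul_row_col !mul0mx !mulNmx mul1mx.
  rewrite addr0 !add0r; set u := usubmx z; set w := dsubmx z.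
  move=> /lev_col_mx[Bu /lev_col_mx[w_ge0 /lev_col_mx[le_c /lev_col_mx[ge_c
    le0]]]].
  exists u, w^T; split=> //.
  - by move=> i; have := w_ge0 i; rewrite !mxE oppr_le0.
  - apply: trmx_inj; rewrite trmx_mul trmxK linearN /=.
    apply/matrixP=> i j; rewrite (ord1 j); apply/le_anti/andP; split=> //.
    by move: ge_c; rewrite -[X in lev _ X]opprK => /levN.
  - by have := le0 0; rewrite mxE [leRHS]mxE (mulmx11_tr w^T) trmxK.
rewrite -(hsubmxK l); set l1 := lsubmx l.
rewrite -(hsubmxK (rsubmx l)); set mu := lsubmx (rsubmx l).
rewrite -(hsubmxK (rsubmx (rsubmx l))); set np := lsubmx _.
rewrite -(hsubmxK (rsubmx (rsubmx (rsubmx l)))); set nm := lsubmx _.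
set kappa := rsubmx _ => /row_mx_ge0[l1_ge0 /row_mx_ge0[mu_ge0]].
move=> /row_mx_ge0[_ /row_mx_ge0[_ kappa_ge0]].
rewrite !mul_row_col !mul_mx_row !add_row_mx !mulmx0 !add0r !addr0 !mulmxN.
rewrite mulmx1 (mx11_scalar kappa) !mul_scalar_mx.
have {kappa_ge0} := kappa_ge0 0; move: (kappa 0 0) => k k_ge0.
case; rewrite -row_mx0 => /eq_row_mx[l1B nuB] lt0.
pose nu := (nm - np)^T.
have {}l1B : l1 *m B = - (k *: c) by apply/eqP; rewrite -addr_eq0 l1B.
(* The slack in this inequality is [mu], the multiplier of [w >= 0]. *)
have {}nuB : lev (B *m nu) (k *: b).
  have -> : B *m nu = k *: b - mu^T.
    apply: trmx_inj; rewrite trmx_mul trmxK linearB /= trmxK linearZ /= mulmxBl.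
    move: (nm *m B^T) (np *m B^T) nuB => P Q nuB; apply/matrixP=> i j.
    by have := congr1 (fun C : 'rV_p => C i j) nuB; rewrite !mxE; lra.
  by move=> i; rewrite [leLHS]mxE gerDl mxE oppr_le0 mxE.
have {}lt0 : (l1 *m b) 0 0 + (c *m nu) 0 0 < 0.
  move: lt0; rewrite (mulmx11_tr c) trmxK mulmxBl.
  by move: (l1 *m b) (nm *m c^T) (np *m c^T) => ? ? ?; rewrite !mxE; lra.
exfalso; have [k0|k_neq0] := eqVneq k 0.
  have := ler_mulmx11 l1_ge0 Bu0; have := ler_mulmx11 w0_ge0 nuB.
  rewrite !mulmxA l1B w0B k0 !scale0r oppr0 mul0mx mulmx0 mulNmx.
  move: lt0; move: (l1 *m b) (c *m nu) => ? ?; rewrite !mxE; lra.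
have k_gt0 : 0 < k by rewrite lt0r k_neq0.
have := ler_mulmx11 l1_ge0 nuB; rewrite mulmxA l1B mulNmx -scalemxAl -scalemxAr.
rewrite [leLHS]mxE [X in - X <= _]mxE [leRHS]mxE -mulrN ler_pM2l //.
by move: lt0; lra.
Qed.

End LinearProgramming.

(** * Faces of polyhedra and bounded solutions *)

Section Polyhedra.
Context {R : realFieldType}.
Variables (p r : nat) (B : 'M[R]_(p, r)).
Implicit Types (d : 'cV[R]_p) (z w : 'cV[R]_r) (J : {set 'I_p}).

Definition active d z : {set 'I_p} := [set i | (B *m z) i 0 == d i 0].

(** Rows outside [J] are zeroed rather than deleted, so that the dimensions do not depend on [J]. *)
Definition mask_rows k J (C : 'M[R]_(p, k)) : 'M[R]_(p, k) :=
  \matrix_(i, j) (if i \in J then C i j else 0).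

Lemma mul_mask_rows J z : mask_rows J B *m z = mask_rows J (B *m z).
Proof.
apply/matrixP=> i j; rewrite !mxE; case: ifP => iJ; rewrite ?mxE.
  by apply: eq_bigr => k _; rewrite mxE iJ.
by rewrite big1 // => k _; rewrite mxE iJ mul0r.
Qed.

Lemma mask_active d z : mask_rows (active d z) B *m z =
  mask_rows (active d z) d.
Proof.
rewrite mul_mask_rows; apply/matrixP=> i j; rewrite !(ord1 j) [LHS]mxE [RHS]mxE.
by case: ifP => //; rewrite inE => /eqP.
Qed.

Lemma mask_eq0 J w :
  mask_rows J B *m w = 0 -> forall i, i \in J -> (B *m w) i 0 = 0.
Proof.
move=> Bw i iJ; have := congr1 (fun C : 'cV_p => C i 0) Bw.
by rewrite mul_mask_rows mxE iJ [RHS]mxE.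
Qed.

(** Ratio test: go from [z] along [w] until the first of the rows violated at [z + w] becomes tight.
    The rows active at [z] stay active because [B *m w] vanishes on them. *)
Lemma extend_active d z w :
  lev (B *m z) d -> (forall i, i \in active d z -> (B *m w) i 0 = 0) ->
  ~ lev (B *m (z + w)) d ->
  exists s, [/\ 0 <= s <= 1, lev (B *m (z + s *: w)) d &
                active d z \proper active d (z + s *: w)].
Proof.
move=> Bz Bw0 Bzw.
have BE i s : (B *m (z + s *: w)) i 0 = (B *m z) i 0 + s * (B *m w) i 0.
  by rewrite mulmxDr -scalemxAr mxE [X in _ + X]mxE.
pose P i := d i 0 - (B *m z) i 0 < (B *m w) i 0.
have [i0 Pi0] : exists i, P i.
  apply: contrapT => nP; apply: Bzw => i; rewrite -[w]scale1r BE mul1r.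
  rewrite -lerBrDl leNgt; apply/negP => Pi; apply: nP; by exists i.
pose F i := (d i 0 - (B *m z) i 0) / (B *m w) i 0.
case: (arg_minP F Pi0) => i Pi Fmin.
have slack j : 0 <= d j 0 - (B *m z) j 0 by rewrite subr_ge0.
have w_gt0 j : P j -> 0 < (B *m w) j 0 by exact: le_lt_trans.
have F_ge0 : 0 <= F i by rewrite divr_ge0 // ltW ?w_gt0.
have F_le1 : F i <= 1 by rewrite ler_pdivrMr ?w_gt0 // mul1r ltW.
exists (F i); rewrite F_ge0 F_le1; split=> //.
  move=> j; rewrite BE -lerBrDl; have [Pj|nPj] := boolP (P j).
    by rewrite -ler_pdivlMr ?w_gt0 //; exact: Fmin.
  have [wj|wj] := leP ((B *m w) j 0) 0.
    by apply: le_trans (slack j); rewrite mulr_ge0_le0.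
  apply: (@le_trans _ _ ((B *m w) j 0)); last by rewrite leNgt.
  by rewrite ler_piMl // ltW.
apply/properP; split.
  by apply/fintype.subsetP=> j jz; rewrite inE BE Bw0 // mulr0 addr0;
    move: jz; rewrite inE.
exists i.
  by rewrite inE BE /F divfK ?lt0r_neq0 ?w_gt0 // addrC subrK.
by apply/negP => /Bw0 w0; have := w_gt0 i Pi; rewrite w0 ltxx.
Qed.

(** As long as some [w] annihilated by the active rows has [B *m w != 0], moving along it makes a
    further row active; the induction is on the number of inactive rows. *)
Lemma minimal_face d z : lev (B *m z) d ->
  exists2 z', lev (B *m z') d &
    forall w, (forall i, i \in active d z' -> (B *m w) i 0 = 0) -> B *m w = 0.
Proof.
have [n] := ubnP #|~: active d z|; elim: n z => // n IHn z.
rewrite ltnS => le_n Bz.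
have [?|/existsNP[w /not_implyP[w0 /eqP nz_w]]] := pselect (forall w,
  (forall i, i \in active d z -> (B *m w) i 0 = 0) -> B *m w = 0).
  by exists z.
have /existsP[i wi] : [exists i, (B *m w) i 0 != 0].
  apply: contra_neqT nz_w; rewrite negb_exists => /forallP w_eq0.
  by apply/matrixP=> i j; rewrite ord1 [RHS]mxE; apply/eqP/negPn/w_eq0.
(* At [z + t *: w] row [i] exceeds its bound by exactly 1, so this move does leave the polyhedron,
   whatever the sign of [(B *m w) i 0]. *)
pose t := (d i 0 - (B *m z) i 0 + 1) / (B *m w) i 0.
have [||s [_ Bs act_s]] := @extend_active d z (t *: w) Bz.
- by move=> j jz; rewrite -scalemxAr mxE w0 // mulr0.
- move/(_ i); rewrite mulmxDr -scalemxAr mxE [X in _ + X]mxE divfK //; lra.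
apply: IHn Bs; apply: leq_trans le_n; apply: proper_card.
by rewrite properC.

Qed.

(* At a point of a minimal face, [B] takes the same value at every solution of
   the active equations; the one given by the pseudo-inverse is bounded. *)
Lemma hoffman_bound : exists C, forall d, (forall i, `|d i 0| <= 1) ->
  (exists z, lev (B *m z) d) ->
  exists2 z, lev (B *m z) d & forall j, `|z j 0| <= C.
Proof.
pose K J := (pinvmx (mask_rows J B)^T)^T.
exists (\sum_J \sum_j \sum_i `|K J j i|) =>
  d d_le1 [z0 /minimal_face[z Bz z_min]].
set J := active d z in z_min *.
(* The pseudo-inverse gives a genuine solution because the active equations are solvable, namely by
   [z]. *)
have KJ : mask_rows J B *m (K J *m mask_rows J d) = mask_rows J d.
  apply: trmx_inj; rewrite !trmx_mul trmxK; apply: mulmxKpV.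
  by rewrite -mask_active trmx_mul submxMl.
exists (K J *m mask_rows J d).
  suff -> : B *m (K J *m mask_rows J d) = B *m z by [].
  apply/eqP; rewrite -subr_eq0 -mulmxBr; apply/eqP/z_min; apply: mask_eq0.
  by rewrite mulmxBr KJ mask_active subrr.
move=> j; rewrite mxE; apply: (@le_trans _ _ (\sum_i `|K J j i|)).
  apply: le_trans (ler_norm_sum _ _ _) _; apply: ler_sum => i _.
  rewrite normrM ler_piMr // mxE; case: ifP => _ //; by rewrite normr0.
have sum_ge0 I0 (I1 : Type) (F : I0 -> I1 -> R) s i :
    0 <= \sum_(k <- s) `|F i k| by apply: sumr_ge0.
rewrite (bigD1 J) //= (bigD1 j) //= -addrA lerDl addr_ge0 //.
  by apply: sumr_ge0.
by apply: sumr_ge0 => J' _; apply: sumr_ge0.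
Qed.

(** * Orthogonal projection onto a polyhedron and its optimality conditions *)

Definition sqnorm k (v : 'cV[R]_k) : R := (v^T *m v) 0 0.

Lemma sqnormE k (v : 'cV[R]_k) : sqnorm v = \sum_i v i 0 ^+ 2.
Proof. by rewrite /sqnorm mxE; apply: eq_bigr => i _; rewrite mxE expr2. Qed.

Lemma sqnorm_ge0 k (v : 'cV[R]_k) : 0 <= sqnorm v.
Proof. by rewrite sqnormE sumr_ge0 // => i _; rewrite sqr_ge0. Qed.

Lemma sqnorm_eq0 k (v : 'cV[R]_k) : sqnorm v = 0 -> v = 0.
Proof.
rewrite sqnormE => /psumr_eq0P v0; apply/matrixP=> i j.
rewrite (ord1 j) [RHS]mxE; apply/eqP; rewrite -sqrf_eq0 v0 //.
by move=> ? _; rewrite sqr_ge0.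
Qed.

Lemma sqnormD k (u v : 'cV[R]_k) :
  sqnorm (u + v) = sqnorm u + 2 * (u^T *m v) 0 0 + sqnorm v.
Proof.
rewrite /sqnorm [(u + v)^T]linearD mulmxDl !mulmxDr mxE [X in X + _]mxE [X in
  _ + X]mxE.
rewrite [(v^T *m u) 0 0]mulmx11_tr trmxK; ring.
Qed.

Lemma sqnormZ k a (u : 'cV[R]_k) : sqnorm (a *: u) = a ^+ 2 * sqnorm u.
Proof.
by rewrite !sqnormE mulr_sumr; apply: eq_bigr => i _; rewrite mxE exprMn.
Qed.

(** The normal equations are solvable: [u *m C *m C^T = 0] forces the squared norm of [u *m C] to
    vanish, so [C *m C^T] has the rank, hence the row space, of [C^T]. Then [v - (l *m C)^T] is the
    projection of [v] onto the kernel of [C]. *)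
Lemma gram_solve k (C : 'M[R]_(k, r)) (v : 'cV[R]_r) :
  exists l : 'rV[R]_k, C *m (l *m C)^T = C *m v.
Proof.
have sub_ker : (kermx (C *m C^T) <= kermx C)%MS.
  apply/sub_kermxP/row_matrixP=> i; rewrite row_mul row0.
  set u := row i _; have : u *m (C *m C^T) = 0.
    by rewrite -row_mul mulmx_ker row0.
  move=> u0; apply: trmx_inj; rewrite trmx0; apply: sqnorm_eq0.
  by rewrite /sqnorm trmxK trmx_mul mulmxA -(mulmxA u) u0 mul0mx mxE.
have leC : (C *m C^T <= C^T)%MS by exact: submxMl.
have eqC : (C^T <= C *m C^T)%MS.
  rewrite -(geq_leqif (mxrank_leqif_sup leC)) mxrank_tr.
  by have := mxrankS sub_ker; rewrite !mxrank_ker leq_sub2lE ?rank_leq_row.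
have /submxP[l lE] : (v^T *m C^T <= C *m C^T)%MS.
  exact: submx_trans (submxMl _ _) eqC.
by exists l; apply: trmx_inj; rewrite (trmx_mul C) trmxK -mulmxA (trmx_mul C v).
Qed.

(** By Pythagoras the squared distance from [z0] to [z + s *: w] is [sqnorm (z0 - z - w) + (1 - s)
    ^+ 2 * sqnorm w]. *)
Lemma segment_closer z0 z s w : 0 <= s <= 1 ->
  ((z0 - z - w)^T *m w) 0 0 = 0 ->
    sqnorm (z0 - (z + s *: w)) <= sqnorm (z0 - z).
Proof.
move=> /andP[s0 s1] orth.
have -> : z0 - (z + s *: w) = (z0 - z - w) + (1 - s) *: w.
  by apply/matrixP=> i j; rewrite !mxE; ring.
rewrite -[in leRHS](subrK w (z0 - z)) !(sqnormD (z0 - z - w)) -scalemxAr.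
rewrite [(_ *: (_ *m _)) 0 0]mxE orth !mulr0 !addr0 lerD2l sqnormZ.
rewrite ler_piMl ?sqnorm_ge0 //.
by rewrite expr_le1 ?subr_ge0 // gerBl.
Qed.

(* [z] is the orthogonal projection of [z0] onto the solutions of the
   equations [(B *m z) i 0 = d i 0], [i \in J]. *)
Definition is_affine_proj d z0 J z :=
  mask_rows J B *m z = mask_rows J d /\
  exists l : 'rV[R]_p, (z0 - z)^T = l *m mask_rows J B.

(** The difference of two such points lies both in the row space and in the kernel of the masked
    matrix, so it is orthogonal to itself. *)
Lemma affine_proj_uniq d z0 J z1 z2 :
  is_affine_proj d z0 J z1 -> is_affine_proj d z0 J z2 -> z1 = z2.
Proof.
move=> [Bz1 [l1 z1E]] [Bz2 [l2 z2E]]; apply/eqP; rewrite -subr_eq0; apply/eqP.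
have eq_l : (z1 - z2)^T = (l2 - l1) *m mask_rows J B.
  rewrite mulmxBl -z1E -z2E -linearB /=.
  by apply/matrixP=> i j; rewrite !mxE; ring.
apply: sqnorm_eq0; rewrite /sqnorm eq_l -mulmxA mulmxBr Bz1 Bz2 subrr.
by rewrite mulmx0 mxE.
Qed.

(** Move from [z] towards the projection of [z0] onto the affine space of the active equations.
    Either it is reached inside the polyhedron, or a new row becomes active on the way and the
    argument is repeated; the distance to [z0] never grows. *)
Lemma closer_affine_proj d z0 z : lev (B *m z) d ->
  exists z' J, [/\ lev (B *m z') d, sqnorm (z0 - z') <= sqnorm (z0 - z) &
                   is_affine_proj d z0 J z'].
Proof.
have [n] := ubnP #|~: active d z|; elim: n z => // n IHn z.
rewrite ltnS => le_n Bz; set J := active d z.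
have [l lE] := gram_solve (mask_rows J B) (z0 - z).
set w := z0 - z - (l *m mask_rows J B)^T.
have Bw : mask_rows J B *m w = 0 by rewrite /w mulmxBr lE subrr.
have wE : z0 - z - w = (l *m mask_rows J B)^T by rewrite /w opprB addrC subrK.
have orth : ((z0 - z - w)^T *m w) 0 0 = 0.
  by rewrite wE trmxK -mulmxA Bw mulmx0 mxE.
have [Bzw|nBzw] := pselect (lev (B *m (z + w)) d).
  exists (z + w), J; split=> //.
    by rewrite -[w]scale1r; apply: segment_closer => //; rewrite ler01 lexx.
  split; first by rewrite mulmxDr Bw addr0 mask_active.
  by exists l; rewrite opprD addrA wE trmxK.
have [s [s01 Bs act_s]] := extend_active Bz (mask_eq0 Bw) nBzw.
have [|//|z' [J' [Bz' le_z' pr_z']]] := IHn (z + s *: w).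
  by apply: leq_trans le_n; apply: proper_card; rewrite properC.
exists z', J'; split=> //; apply: le_trans le_z' _.
exact: segment_closer.
Qed.

(** No compactness is used: by [closer_affine_proj] only projections onto the affine spaces of row
    sets [J] compete, at most one for each [J] by uniqueness, and a finite family has a minimum. *)
Lemma polyhedron_proj d z0 : (exists z, lev (B *m z) d) ->
  exists2 z, lev (B *m z) d &
    forall z', lev (B *m z') d -> sqnorm (z0 - z) <= sqnorm (z0 - z').
Proof.
move=> [z1 Bz1].
(* [f J] is the projection for [J] if that is feasible, and the feasible point [z1] otherwise, so
   that every candidate is feasible. *)
have /choice[f fP] J : exists z, lev (B *m z) d /\
    ((exists2 z', lev (B *m z') d & is_affine_proj d z0 J z') ->
      is_affine_proj d z0 J z).
  have [[z' Bz' pr_z']|nz'] := pselect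
    (exists2 z', lev (B *m z') d & is_affine_proj d z0 J z'); last by exists z1.
  by exists z'.
have [|J _ Jmin] := @arg_minP _ _ _ finset.set0 xpredT (fun J =>
  sqnorm (z0 - f J)).
  by [].
exists (f J); first by case: (fP J).
move=> z /(closer_affine_proj z0)[z' [J' [Bz' le_z' pr_z']]].
apply: le_trans (Jmin J' isT) _.
by have [_ /(_ (ex_intro2 _ _ z' Bz' pr_z')) /affine_proj_uniq/(_ pr_z') ->]
  := fP J'.
Qed.

Lemma feasible_direction d z w : lev (B *m z) d ->
  (forall i, i \in active d z -> (B *m w) i 0 <= 0) ->
  exists2 e, 0 < e & forall s, 0 <= s <= e -> lev (B *m (z + s *: w)) d.
Proof.
move=> Bz Bw; pose slack i := d i 0 - (B *m z) i 0.
have slack_ge0 i : 0 <= slack i by rewrite subr_ge0.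
(* Active rows have slack 0 and contribute 0, as division by 0 gives 0. The step [(1 + S)^-1]
   changes each inactive row by at most its slack. *)
pose S := \sum_i `|(B *m w) i 0| / slack i.
have S_ge0 : 0 <= S by apply: sumr_ge0 => i _; rewrite divr_ge0.
exists (1 + S)^-1; first by rewrite invr_gt0 ltr_pwDl.
move=> s /andP[s0 sS] i.
rewrite mulmxDr -scalemxAr mxE [X in _ + X]mxE -lerBrDl -/(slack i).
have [act_i|act_i] := boolP (i \in active d z).
  by apply: le_trans (slack_ge0 i); rewrite mulr_ge0_le0 // Bw.
have slack_gt0 : 0 < slack i.
  by rewrite lt0r slack_ge0 subr_eq0 eq_sym andbT; move: act_i; rewrite inE.
apply: (@le_trans _ _ ((1 + S)^-1 * `|(B *m w) i 0|)).
  by apply: le_trans (ler_wpM2l s0 (ler_norm _)) _; rewrite ler_wpM2r.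
rewrite ler_pdivrMl ?ltr_pwDl // -ler_pdivrMr //.
rewrite /S (bigD1 i) //= addrCA lerDl addr_ge0 // sumr_ge0 // => j _.
by rewrite divr_ge0.
Qed.

(** By [farkas] on the active rows, either [z0 - z] is a nonnegative combination of them, or some
    [w] along which one can move feasibly makes a positive inner product with [z0 - z]; a short move
    along [w] would then come closer to [z0]. *)
Lemma polyhedron_proj_kkt d z0 z : lev (B *m z) d ->
  (forall z', lev (B *m z') d -> sqnorm (z0 - z) <= sqnorm (z0 - z')) ->
  exists2 l : 'rV[R]_p, (forall i, 0 <= l 0 i) &
    (forall i, i \notin active d z -> l 0 i = 0) /\ (z0 - z)^T = l *m B.
Proof.
move=> Bz z_min.
have [[l l0 lE]|[w Bw zw]] := farkas (mask_rows (active d z) B) (z0 - z)^T.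
  exists (\row_i (if i \in active d z then l 0 i else 0)).
    by move=> i; rewrite mxE; case: ifP.
  split=> [i /negPf iz|]; first by rewrite mxE iz.
  rewrite lE; apply/matrixP=> i j; rewrite !mxE; apply: eq_bigr => k _.
  by rewrite !mxE (ord1 i); case: ifP; rewrite ?mulr0 ?mul0r.
have [|e e0 eP] := feasible_direction (w := w) Bz.
  by move=> i iz; have := Bw i; rewrite mul_mask_rows mxE iz [leRHS]mxE.
set a := (_ *m w) 0 0 in zw; set b := sqnorm w.
have b_ge0 : 0 <= b by exact: sqnorm_ge0.
have b1_gt0 : 0 < b + 1 by rewrite ltr_wpDl.
(* The squared distance changes by [- 2 s a + s^2 b], which is negative as soon as [s b <= a];
   adding 1 to [b] keeps the denominator positive. *)
pose s := Num.min e (a / (b + 1)).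
have s_gt0 : 0 < s by rewrite lt_min e0 divr_gt0.
have sb : s * b <= a.
  apply: (@le_trans _ _ (s * (b + 1))); first by rewrite ler_pM2l // lerDl.
  by rewrite -ler_pdivlMr // ge_min lexx orbT.
have := z_min _ (eP s _); rewrite ltW //= ge_min lexx => /(_ isT).
rewrite opprD addrA -scaleNr (sqnormD (z0 - z)) -scalemxAr.
rewrite [(_ *: (_ *m _)) 0 0]mxE sqnormZ -/a -/b.
by nra.
Qed.

End Polyhedra.

(** * Elementary inequalities between norms *)

Section Norms.
Context {R : realType}.

Lemma linfnorm_ge0 k (x : 'cV[R]_k) : 0 <= linfnorm x.
Proof. by rewrite /linfnorm mx_normrE; exact: bigmax_ge_id. Qed.

Lemma normr_le_linfnorm k (x : 'cV[R]_k) i : `|x i 0| <= linfnorm x.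
Proof.
by rewrite /linfnorm mx_normrE; apply: (@le_bigmax _ _ _ _ _ (i, 0)).
Qed.

Lemma linfnorm_le k (x : 'cV[R]_k) C :
  0 <= C -> (forall i, `|x i 0| <= C) -> linfnorm x <= C.
Proof.
move=> C0 xC; rewrite /linfnorm mx_normrE; apply: bigmax_le => // -[i j] _ /=.
by rewrite ord1.
Qed.

Lemma l1norm_ge0 k (x : 'cV[R]_k) : 0 <= l1norm x.
Proof. exact: sumr_ge0. Qed.

Lemma linfnorm_le_l1norm k (x : 'cV[R]_k) : linfnorm x <= l1norm x.
Proof.
apply: linfnorm_le => [|i]; first exact: l1norm_ge0.
by rewrite /l1norm (bigD1 i) //= lerDl sumr_ge0.
Qed.

Lemma l1norm0 k : l1norm (0 : 'cV[R]_k) = 0.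
Proof. by rewrite /l1norm big1 // => i _; rewrite mxE normr0. Qed.

Lemma l1norm_col_mx k1 k2 (x : 'cV[R]_k1) (y : 'cV[R]_k2) :
  l1norm (col_mx x y) = l1norm x + l1norm y.
Proof.
rewrite /l1norm big_split_ord /=; congr (_ + _); apply: eq_bigr => i _.
  by rewrite col_mxEu.
by rewrite col_mxEd.
Qed.

Lemma l1norm_scalar (a : R) : l1norm (a%:M : 'cV_1) = `|a|.
Proof. by rewrite /l1norm big_ord1 mxE eqxx. Qed.

Lemma ler_norm_mulmx11 k (u v : 'cV[R]_k) :
  `|(u^T *m v) 0 0| <= linfnorm u * l1norm v.
Proof.
rewrite mxE; apply: le_trans (ler_norm_sum _ _ _) _.
rewrite mulr_sumr; apply: ler_sum => i _; rewrite mxE normrM ler_wpM2r //.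
exact: normr_le_linfnorm.
Qed.

Lemma l2normE k (x : 'cV[R]_k) : l2norm x = Num.sqrt (sqnorm x).
Proof. by rewrite sqnormE. Qed.

Lemma l2norm_ge0 k (x : 'cV[R]_k) : 0 <= l2norm x.
Proof. exact: sqrtr_ge0. Qed.

Lemma normr_le_l2norm k (x : 'cV[R]_k) i : `|x i 0| <= l2norm x.
Proof.
rewrite -sqrtr_sqr ler_sqrt; last by apply: sumr_ge0 => j _; rewrite sqr_ge0.
by rewrite (bigD1 i) //= lerDl sumr_ge0 // => j _; rewrite sqr_ge0.
Qed.

Lemma l2norm_usubmx k1 k2 (x : 'cV[R]_(k1 + k2)) : l2norm (usubmx x) <=
  l2norm x.
Proof.
rewrite ler_sqrt; last by apply: sumr_ge0 => j _; rewrite sqr_ge0.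
rewrite big_split_ord /= -[X in X <= _]addr0 lerD //.
  by apply: ler_sum => i _; rewrite mxE.
by apply: sumr_ge0 => j _; rewrite sqr_ge0.
Qed.

End Norms.

(** * Robinson's error bound for linear systems *)

Section Robinson.
Context {R : realType}.

Lemma lev_eq_system p1 p2 r (N1 : 'M[R]_(p1, r)) (N2 : 'M[R]_(p2, r)) b1 b2 z :
  lev (col_mx N1 (col_mx N2 (- N2)) *m z) (col_mx b1 (col_mx b2 (- b2))) <->
  lev (N1 *m z) b1 /\ N2 *m z = b2.
Proof.
rewrite !mul_col_mx mulNmx; split.
  move=> /lev_col_mx[le1 /lev_col_mx[le2 /levN ge2]]; split=> //.
  apply/matrixP=> i j; rewrite (ord1 j); apply/le_anti/andP; split=> //.
move=> [le1 eq2]; apply/lev_col_mx; split=> //.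
by apply/lev_col_mx; rewrite eq2; split; exact: lev_refl.
Qed.

Local Notation linf := (@linfnorm R).
Local Notation l2 := (@l2norm R).

(** The supremum in [robinson_mu] dominates its members only if they are bounded above.
    [hoffman_bound] provides one bound for all right-hand sides of norm at most 1, each equation
    being read as two inequalities. *)
Lemma robinson_mu_ge p1 p2 r (M1 : 'M[R]_(p1, r)) (M2 : 'M[R]_(p2, r)) d1 d2 :
  (lin_system M1 M2 d1 d2 !=set0)%classic -> l2norm (col_mx d1 d2) <= 1 ->
  inf [set linfnorm u | u in lin_system M1 M2 d1 d2]%classic <=
    robinson_mu linf l2 M1 M2.
Proof.
move=> ne le1; apply: ub_le_sup; last by exists (d1, d2).
have [C CP] := hoffman_bound (col_mx M1 (col_mx M2 (- M2))).
exists (Num.max C 0) => _ [[e1 e2] /= [[u Mu] e_le1] <-].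
have [|z /lev_eq_system Mz zC] := CP (col_mx e1 (col_mx e2 (- e2))) _
  (ex_intro _ u (proj2 (lev_eq_system _ _ _ _ _) Mu)).
  have e_le i := le_trans (normr_le_l2norm (col_mx e1 e2) i) e_le1.
  move=> i; case: (split_ordP i) => j ->; rewrite ?col_mxEu ?col_mxEd.
    by have := e_le (lshift _ j); rewrite col_mxEu.
  case: (split_ordP j) => k ->; rewrite ?col_mxEu ?col_mxEd ?mxE ?normrN.
    by have := e_le (rshift _ k); rewrite col_mxEd.
  by have := e_le (rshift _ k); rewrite col_mxEd.
apply: (@le_trans _ _ (linfnorm z)).
  apply: ge_inf; last by exists z.
  by exists 0 => _ [v _ <-]; exact: linfnorm_ge0.
apply: linfnorm_le => [|i]; first by rewrite le_max lexx orbT.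
by rewrite le_max zC.
Qed.

Lemma robinson_sigma_ge0 p1 p2 r (N1 : 'M[R]_(p1, r)) (N2 : 'M[R]_(p2, r)) :
  0 <= robinson_sigma linf l2 N1 N2.
Proof. exact: bigmax_ge_id. Qed.

(* If [z] is the projection of [z0], its optimality conditions express the unit
   vector along [z0 - z] through the rows of [N1] active at [z] and those of
   [N2]. Every such expression [u] bounds [l2norm (z0 - z)] by
   [linfnorm u] times the residual of [z0]; the best one is measured by
   [robinson_mu] for [S] the set of inactive rows. *)
Lemma robinson_bound p1 p2 r (N1 : 'M[R]_(p1, r)) (N2 : 'M[R]_(p2, r))
    b1 b2 z0 d1 d2 :
  (exists z, lev (N1 *m z) b1 /\ N2 *m z = b2) ->
  lev 0 d1 -> lev (N1 *m z0) (b1 + d1) -> N2 *m z0 = b2 + d2 ->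
  exists z, [/\ lev (N1 *m z) b1, N2 *m z = b2 &
    l2norm (z0 - z) <= robinson_sigma linf l2 N1 N2 * (l1norm d1 + l1norm d2)].
Proof.
move=> [z1 /lev_eq_system Nz1] d1_ge0 N1z0 N2z0.
have [z Nz z_min] := polyhedron_proj z0 (ex_intro _ z1 Nz1).
have [l l_ge0 [l_act lE]] := polyhedron_proj_kkt Nz z_min.
have [N1z N2z] := (lev_eq_system _ _ _ _ _).1 Nz.
exists z; split=> //.
set rho := l1norm d1 + l1norm d2; set delta := l2norm (z0 - z).
have rho_ge0 : 0 <= rho by rewrite addr_ge0 ?l1norm_ge0.
have sigma_ge0 := robinson_sigma_ge0 N1 N2.
have [->|delta_neq0] := eqVneq delta 0; first exact: mulr_ge0.
have delta_gt0 : 0 < delta by rewrite lt0r delta_neq0 l2norm_ge0.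
pose S : {set 'I_p1} := ~: active N1 b1 z.
pose e := delta^-1 *: (z0 - z).
have sq_delta : ((z0 - z)^T *m (z0 - z)) 0 0 = delta ^+ 2.
  by rewrite /delta l2normE sqr_sqrtr // sqnorm_ge0.
have e_z : (e^T *m (z0 - z)) 0 0 = delta.
  by rewrite linearZ /= -scalemxAl mxE sq_delta expr2 mulKf.
have e_norm : l2norm e = 1.
  rewrite l2normE sqnormZ /sqnorm sq_delta -exprMn mulVf //.
  by rewrite expr1n sqrtr1.
have systemE (u1 : 'cV[R]_p1) (u2 : 'cV[R]_p2) :
    lin_system (block_mx (rows_of_id S) (0 : 'M_(#|S|, p2))
                         (- 1%:M) (0 : 'M_(p1, p2)))
               (col_mx N1 N2)^T 0 e (col_mx u1 u2) <->
    [/\ forall i, i \in S -> u1 i 0 <= 0, forall i, 0 <= u1 i 0 &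
        N1^T *m u1 + N2^T *m u2 = e].
  rewrite /lin_system /= mul_block_col tr_col_mx mul_row_col !mul0mx !addr0.
  rewrite mulNmx mul1mx mul_rowsub_mx mul1mx.
  split=> [[/lev_col_mx0[u1S u1_ge0] ->]|[u1S u1_ge0 ->]]; split=> //.
  - by move=> i iS; have := u1S (enum_rank_in iS i); rewrite !mxE enum_rankK_in.
  - by move=> i; have := u1_ge0 i; rewrite !mxE oppr_le0.
  - apply/lev_col_mx0; split=> i; last by rewrite !mxE oppr_le0.
    by rewrite !mxE u1S // enum_valP.
set sys := lin_system _ _ _ _ in systemE.
(* Pair [e = N1^T u1 + N2^T u2] with [z0 - z]. Where [u1] is nonzero the row is active at [z], so
   the entry of [N1 (z0 - z)] is at most that of [d1]; and [N2 (z0 - z) = d2]. *)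
have sys_le u : sys u -> delta <= linfnorm u * rho.
  rewrite -(vsubmxK u); set u1 := usubmx u; set u2 := dsubmx u.
  move=> /systemE[u1S u1_ge0 uE].
  rewrite -e_z -uE [(_ + _)^T]linearD /= !trmx_mul !trmxK mulmxDl mxE -!mulmxA.
  rewrite mulrDr.
  have le_linf1 : linfnorm u1 <= linfnorm (col_mx u1 u2).
    apply: linfnorm_le => [|i]; first exact: linfnorm_ge0.
    by have := normr_le_linfnorm (col_mx u1 u2) (lshift _ i); rewrite col_mxEu.
  have le_linf2 : linfnorm u2 <= linfnorm (col_mx u1 u2).
    apply: linfnorm_le => [|i]; first exact: linfnorm_ge0.
    by have := normr_le_linfnorm (col_mx u1 u2) (rshift _ i); rewrite col_mxEd.
  apply: lerD.
    apply: (@le_trans _ _ ((u1^T *m d1) 0 0)).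
      rewrite !mxE; apply: ler_sum => i _; rewrite [u1^T 0 i]mxE.
      have [iS|] := boolP (i \in S).
        have -> : u1 i 0 = 0 by apply/le_anti; rewrite u1S // u1_ge0.
        by rewrite !mul0r.
      rewrite inE negbK inE => /eqP N1zi; rewrite ler_wpM2l //.
      rewrite mulmxBr mxE [X in _ + X]mxE N1zi lerBlDl.
      by have := N1z0 i; rewrite [leRHS]mxE.
    apply: le_trans (ler_norm _) (le_trans (ler_norm_mulmx11 _ _) _).
    by rewrite ler_wpM2r ?l1norm_ge0.
  rewrite mulmxBr N2z0 N2z [b2 + d2]addrC addrK.
  apply: le_trans (ler_norm _) (le_trans (ler_norm_mulmx11 _ _) _).
  by rewrite ler_wpM2r ?l1norm_ge0.
(* The multipliers of the projection, divided by [delta]; those of the two opposite inequalities of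
   an equation are subtracted. *)
have sys_ne : (sys !=set0)%classic.
  move: lE l_ge0 l_act; rewrite -(hsubmxK l) -(hsubmxK (rsubmx l)).
  set l1 := lsubmx l; set l2 := lsubmx _; set l3 := rsubmx _.
  rewrite !mul_row_col => lE /row_mx_ge0[l1_ge0 _] l_act.
  exists (col_mx (delta^-1 *: l1^T) (delta^-1 *: (l2 - l3)^T)).
  apply/systemE; split.
  - move=> i; rewrite !inE => iS; rewrite mxE [l1^T i 0]mxE.
    have := l_act (lshift _ i); rewrite row_mxEl => ->; first by rewrite mulr0.
    by rewrite inE mul_col_mx !col_mxEu.
  - by move=> i; rewrite mxE [l1^T i 0]mxE mulr_ge0 // invr_ge0 ltW.
  - rewrite -!scalemxAr -scalerDr /e; congr (_ *: _).
    apply: trmx_inj; rewrite lE linearD /= !trmx_mul !trmxK; congr (_ + _).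
    by rewrite mulmxBl mulmxN.
have rho_gt0 : 0 < rho.
  rewrite lt0r rho_ge0 andbT; apply: contraTneq delta_gt0 => rho0.
  have [u /sys_le] := sys_ne; rewrite rho0 mulr0 => delta_le0.
  by rewrite -leNgt.
rewrite -ler_pdivrMr //.
have le_mu : inf [set linfnorm u | u in sys]%classic <=
  robinson_sigma linf l2 N1 N2.
  apply: le_trans (robinson_mu_ge sys_ne _) _.
    rewrite l2normE sqnormE big_split_ord /= big1; last first.
      by move=> i _; rewrite col_mxEu mxE expr0n.
    rewrite add0r -e_norm ler_sqrt; last by apply: sumr_ge0 => i _;
      rewrite sqr_ge0.
    by apply: ler_sum => i _; rewrite col_mxEd.
  exact: (le_bigmax _ _ S).
apply: le_trans le_mu; apply: lb_le_inf.
  by have [u sys_u] := sys_ne; exists (linfnorm u), u.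
by move=> _ [u /sys_le le_u <-]; rewrite ler_pdivrMr.
Qed.

End Robinson.

(** * Primal-dual optimal pairs as the polyhedron of [matM1] and [matM2] *)

Section OptimalityPolyhedron.
Context {R : realType}.
Variables (m n q : nat) (A : 'M[R]_(m, n)) (M : 'M[R]_(m, q)) (y : 'cV[R]_m).
Variables (tau alpha : R).

Definition pd_point (x t : 'cV[R]_n) (xi : R) (v : 'cV[R]_q)
    (w1 w2 : 'cV[R]_n) (w3 : R) (w4 w5 w6 w7 : 'cV[R]_q) :=
  col_mx x (col_mx t (col_mx (xi%:M : 'cV_1) (col_mx v (col_mx w1 (col_mx w2
  (col_mx (w3%:M : 'cV_1) (col_mx w4 (col_mx w5 (col_mx w6 w7))))))))).

Lemma pd_pointP z : exists x t xi v w1 w2 w3 w4 w5 w6 w7,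
  z = pd_point x t xi v w1 w2 w3 w4 w5 w6 w7.
Proof.
rewrite -(vsubmxK z); move: (usubmx z) (dsubmx z) => x {}z.
rewrite -(vsubmxK z); move: (usubmx z) (dsubmx z) => t {}z.
rewrite -(vsubmxK z); move: (usubmx z) (dsubmx z) => xi {}z.
rewrite -(vsubmxK z); move: (usubmx z) (dsubmx z) => v {}z.
rewrite -(vsubmxK z); move: (usubmx z) (dsubmx z) => w1 {}z.
rewrite -(vsubmxK z); move: (usubmx z) (dsubmx z) => w2 {}z.
rewrite -(vsubmxK z); move: (usubmx z) (dsubmx z) => w3 {}z.
rewrite -(vsubmxK z); move: (usubmx z) (dsubmx z) => w4 {}z.
rewrite -(vsubmxK z); move: (usubmx z) (dsubmx z) => w5 {}z.
rewrite -(vsubmxK z); move: (usubmx z) (dsubmx z) => w6 w7.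
exists x, t, (xi 0 0), v, w1, w2, (w3 0 0), w4, w5, w6, w7.
by rewrite /pd_point -!mx11_scalar.
Qed.

(** The budget is a parameter because the completion of the given [x] satisfies the inequalities
    only with a budget larger than [tau] when [x] is infeasible. *)
Definition pd_rhs (s : R) : 'cV[R]_(n + (n + (1 + (q + (q + (q + (q + (n +
    (1 + (q + (n + (n + (1 + (q + (q + (q + q)))))))))))))))) :=
  col_mx 0 (col_mx 0 (col_mx s%:M (col_mx (M^T *m y) (col_mx (- (M^T *m y))
  (col_mx (M^T *m y) (col_mx (- (M^T *m y)) (col_mx (const_mx 1) (col_mx 0
  (col_mx 0 (col_mx 0 (col_mx 0 (col_mx 0 (col_mx 0 (col_mx 0
  (col_mx 0 0))))))))))))))).

Definition primal_ineqs (s : R) (x t : 'cV[R]_n) (xi : R) (v : 'cV[R]_q) :=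
  [/\ forall i, `|x i 0| <= t i 0,
      alpha * xi + (1 - alpha) * (\sum_i v i 0) <= s,
      forall i, `|residual A M y x i 0| <= xi &
      forall i, `|residual A M y x i 0| <= v i 0].

Definition dual_ineqs (w1 w2 : 'cV[R]_n) (w3 : R) (w4 w5 w6 w7 : 'cV[R]_q) :=
  [/\ forall i, w1 i 0 + w2 i 0 <= 1,
      \sum_i w4 i 0 + \sum_i w5 i 0 <= alpha * w3,
      forall i, w6 i 0 + w7 i 0 <= (1 - alpha) * w3 &
      [/\ lev 0 w1, lev 0 w2 & 0 <= w3] /\
      [/\ lev 0 w4, lev 0 w5, lev 0 w6 & lev 0 w7]].

Lemma forall_norm_le k (a b : 'I_k -> R) : (forall i, `|a i| <= b i) <->
  (forall i, a i <= b i) /\ (forall i, - a i <= b i).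
Proof.
split=> [le_b|[le1 le2] i]; last by rewrite ler_norml lerNl le1 le2.
by split=> i; have := le_b i; rewrite ler_norml lerNl => /andP[].
Qed.

Lemma block_rowM p (Bx Bt : 'M[R]_(p, n)) (Bxi : 'M[R]_(p, 1))
    (Bv : 'M[R]_(p, q)) (B1 B2 : 'M[R]_(p, n)) (B3 : 'M[R]_(p, 1))
    (B4 B5 B6 B7 : 'M[R]_(p, q)) x t xi v w1 w2 w3 w4 w5 w6 w7 :
  block_row Bx Bt Bxi Bv B1 B2 B3 B4 B5 B6 B7 *m
    pd_point x t xi v w1 w2 w3 w4 w5 w6 w7 =
  Bx *m x + (Bt *m t + (xi *: Bxi + (Bv *m v + (B1 *m w1 + (B2 *m w2 +
    (w3 *: B3 + (B4 *m w4 + (B5 *m w5 + (B6 *m w6 + B7 *m w7))))))))).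
Proof. by rewrite /block_row /pd_point !mul_row_col !mul_mx_scalar. Qed.

Lemma lev_col_mulmx p1 p2 r (C : 'M[R]_(p1, r)) (D : 'M[R]_(p2, r)) z b d P Q :
  (lev (C *m z) b <-> P) -> (lev (D *m z) d <-> Q) ->
  lev (col_mx C D *m z) (col_mx b d) <-> P /\ Q.
Proof. by move=> <- <-; rewrite mul_col_mx; exact: lev_col_mx. Qed.

Lemma matM1P (x t : 'cV[R]_n) (xi : R) (v : 'cV[R]_q)
    (w1 w2 : 'cV[R]_n) (w3 : R) (w4 w5 w6 w7 : 'cV[R]_q) s :
  lev (matM1 A M alpha *m pd_point x t xi v w1 w2 w3 w4 w5 w6 w7) (pd_rhs s) <->
  primal_ineqs s x t xi v /\ dual_ineqs w1 w2 w3 w4 w5 w6 w7.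
Proof.
set z := pd_point _ _ _ _ _ _ _ _ _ _ _.
pose theta := residual A M y x.
have thetaE i : theta i 0 = (M^T *m A *m x) i 0 - (M^T *m y) i 0.
  by rewrite /theta /residual mulmxBr mulmxA mxE [X in _ + X]mxE.
have sumE k (u : 'cV[R]_k) : ((const_mx 1 : 'rV[R]_k) *m u) 0 0 = \sum_i u i 0.
  by rewrite mxE; apply: eq_bigr => i _; rewrite mxE mul1r.
have simplE := (mul0mx, scaler0, add0r, addr0, mulNmx, mul1mx).
have ge0E k (u : 'cV[R]_k) : lev (- u) 0 <-> lev 0 u.
  by rewrite -[X in lev _ X]oppr0; exact: levN.
have entry11 (P : 'I_1 -> Prop) : (forall i, P i) <-> P 0.
  by split=> // P0 i; rewrite (ord1 i).
(* The conditions are listed one per block row of [matM1], in the same order, so that the blocks can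
   be matched one by one. *)
have -> : (primal_ineqs s x t xi v /\ dual_ineqs w1 w2 w3 w4 w5 w6 w7) <->
  ((forall i, x i 0 - t i 0 <= 0) /\ ((forall i, - x i 0 - t i 0 <= 0) /\
  (alpha * xi + (1 - alpha) * (\sum_i v i 0) <= s /\
  ((forall i, theta i 0 <= xi) /\ ((forall i, - theta i 0 <= xi) /\
  ((forall i, theta i 0 <= v i 0) /\ ((forall i, - theta i 0 <= v i 0) /\
  ((forall i, w1 i 0 + w2 i 0 <= 1) /\
  (\sum_i w4 i 0 + \sum_i w5 i 0 <= alpha * w3 /\
  ((forall i, w6 i 0 + w7 i 0 <= (1 - alpha) * w3) /\
  (lev 0 w1 /\ (lev 0 w2 /\ (0 <= w3 /\ (lev 0 w4 /\ (lev 0 w5 /\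
  (lev 0 w6 /\ lev 0 w7)))))))))))))))).
  rewrite /primal_ineqs /dual_ineqs -/theta.
  split.
    move=> [[/forall_norm_le[? ?] ? /forall_norm_le[? ?] /forall_norm_le[? ?]]
      [? ? ? [[? ? ?] [? ? ? ?]]]].
    by do !split=> //; move=> i; rewrite subr_le0.
  move=> [h1] [h2] [?] [?] [?] [?] [?] [?] [?] [?] [?] [?] [?] [?] [?] [? ?].
  split; split=> //; apply/forall_norm_le; split=> // i.
    by have := h1 i; rewrite subr_le0.
  by have := h2 i; rewrite subr_le0.
rewrite /matM1 /pd_rhs.
do 16 ?apply: lev_col_mulmx; rewrite {}/z block_rowM ?simplE.
- by split=> h i; have := h i; rewrite !mxE.
- by split=> h i; have := h i; rewrite !mxE.
- rewrite /lev entry11 [leLHS]mxE -scalemxAl [X in _ + X]mxE sumE !mxE eqxx.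
  by rewrite mulrC.
- split=> h i; have := h i; rewrite thetaE !(mxE _ _ i 0); lra.
- split=> h i; have := h i; rewrite thetaE !(mxE _ _ i 0); lra.
- split=> h i; have := h i; rewrite thetaE !(mxE _ _ i 0); lra.
- split=> h i; have := h i; rewrite thetaE !(mxE _ _ i 0); lra.
- by split=> h i; have := h i; rewrite !mxE.
- rewrite /lev entry11 [leLHS]mxE [X in _ + X]mxE !sumE !mxE eqxx mulr1n.
  by rewrite mulrN mulrC addrC subr_le0.
- by split=> h i; have := h i; rewrite !mxE mulr1; lra.
- exact: ge0E.
- exact: ge0E.
- by rewrite /lev entry11 !mxE eqxx mulrN1 oppr_le0.
- exact: ge0E.
- exact: ge0E.
- exact: ge0E.
- exact: ge0E.
Qed.

Lemma matM2E (x t : 'cV[R]_n) (xi : R) (v : 'cV[R]_q)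
    (w1 w2 : 'cV[R]_n) (w3 : R) (w4 w5 w6 w7 : 'cV[R]_q) :
  let h := w4 - w5 - w6 + w7 in
  matM2 A M y tau *m pd_point x t xi v w1 w2 w3 w4 w5 w6 w7 =
  col_mx (A^T *m (M *m h) - (w1 - w2))
         (\sum_i t i 0 + tau * w3 - (y^T *m (M *m h)) 0 0)%:M.
Proof.
move=> h; rewrite /matM2 mul_col_mx !block_rowM; congr col_mx.
  rewrite !(mul0mx, scaler0, add0r) !mulNmx !mul1mx -!mulmxA /h !mulmxDr
    !mulmxN.
  move: (A^T *m (M *m w4)) (A^T *m (M *m w5)) => a4 a5.
  move: (A^T *m (M *m w6)) (A^T *m (M *m w7)) => a6 a7.
  apply/matrixP=> i j; rewrite !mxE.
  move: (w1 i j) (w2 i j) (a4 i j) (a5 i j) (a6 i j) (a7 i j) => *; ring.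
rewrite !(mul0mx, scaler0, add0r) !mulNmx -!mulmxA /h !mulmxDr !mulmxN.
apply/matrixP=> i j; rewrite !ord1 [RHS]mxE eqxx mulr1n.
have -> : \sum_i t i 0 = ((const_mx 1 : 'rV[R]_n) *m t) 0 0.
  by rewrite mxE; apply: eq_bigr => k _; rewrite mxE mul1r.
rewrite scale_scalar_mx.
move: (const_mx 1 *m t) (y^T *m (M *m w4)) (y^T *m (M *m w5)) => a1 a4 a5.
move: (y^T *m (M *m w6)) (y^T *m (M *m w7)) => a6 a7.
rewrite !mxE eqxx mulr1n.
by move: (a1 0 0) (a4 0 0) (a5 0 0) (a6 0 0) (a7 0 0) => *; ring.
Qed.

Hypotheses (tau_ge0 : 0 <= tau) (alpha01 : 0 <= alpha <= 1).

Definition optimal_pair x t xi v w1 w2 w3 w4 w5 w6 w7 :=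
  let z := pd_point x t xi v w1 w2 w3 w4 w5 w6 w7 in
  lev (matM1 A M alpha *m z) (pd_rhs tau) /\ matM2 A M y tau *m z = 0.

Lemma feasibleP_primal x t xi v :
  primal_ineqs tau x t xi v -> feasibleP A M y tau alpha x.
Proof.
case/andP: alpha01 => a0 a1 [_ le_tau le_xi le_v]; rewrite /feasibleP.
have le1 : l1norm (residual A M y x) <= \sum_i v i 0 by exact: ler_sum.
(* If [q = 0], then [xi] is unconstrained and may be negative. *)
case: (pickP 'I_q) => [i _|q0].
  apply: le_trans le_tau; apply: lerD; rewrite ler_wpM2l ?subr_ge0 //.
  apply: linfnorm_le => //; exact: le_trans (le_xi i).
have -> : linfnorm (residual A M y x) = 0.
  apply/le_anti; rewrite linfnorm_ge0 andbT linfnorm_le // => i.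
  by have := q0 i.
by rewrite mulr0 add0r /l1norm big1 ?mulr0 // => i; have := q0 i.
Qed.

Lemma mulmx11_sum k (u v : 'cV[R]_k) : (u^T *m v) 0 0 = \sum_i u i 0 * v i 0.
Proof. by rewrite mxE; apply: eq_bigr => i _; rewrite mxE. Qed.

(** Substitute [y = A x - (A x - y)]: the dual objective is expressed through the residual at an
    arbitrary [x]. *)
Lemma dual_value (x : 'cV[R]_n) (h : 'cV[R]_q) :
  (y^T *m (M *m h)) 0 0 =
  (x^T *m (A^T *m (M *m h))) 0 0 - ((residual A M y x)^T *m h) 0 0.
Proof.
rewrite /residual !trmx_mul trmxK linearB /= trmx_mul mulmxBl.
rewrite mulmxBl !mulmxA [X in _ = _ - X]mxE [X in _ = _ - (_ + X)]mxE; ring.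
Qed.

(** Weak duality. The entries of [w1 - w2] are at most 1 in absolute value. The part [w5 - w4] of
    [- h] has l1 norm at most [alpha * w3] and is paired with [linfnorm th]; the part [w6 - w7] has
    entries at most [(1 - alpha) * w3] and is paired with [l1norm th]. Together they give at most
    [w3] times the left side of the constraint. *)
Lemma dual_le_l1norm (x w1 w2 : 'cV[R]_n) (w3 : R) (w4 w5 w6 w7 : 'cV[R]_q) :
  feasibleP A M y tau alpha x -> dual_ineqs w1 w2 w3 w4 w5 w6 w7 ->
  let h := w4 - w5 - w6 + w7 in
  A^T *m (M *m h) = w1 - w2 ->
  (y^T *m (M *m h)) 0 0 - tau * w3 <= l1norm x.
Proof.
case/andP: alpha01 => a0 a1 feas_x [w12 w45 w67 [[w1_0 w2_0 w3_0] [w4_0 w5_0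
  w6_0 w7_0]]].
move=> h Ah; set th := residual A M y x.
rewrite (dual_value x) Ah -/th.
have le_x : (x^T *m (w1 - w2)) 0 0 <= l1norm x.
  rewrite mulmx11_sum; apply: ler_sum => i _.
  apply: le_trans (ler_norm _) _; rewrite normrM ler_piMr // !mxE.
  have := w12 i; have := w1_0 i; have := w2_0 i; rewrite !mxE => *.
  rewrite ler_norml; lra.
have le_th : - (th^T *m h) 0 0 <= tau * w3.
  have le45 : (th^T *m (w5 - w4)) 0 0 <= linfnorm th * (alpha * w3).
    apply: le_trans (ler_norm _) (le_trans (ler_norm_mulmx11 _ _) _).
    apply: ler_wpM2l; first exact: linfnorm_ge0.
    apply: le_trans w45; rewrite -big_split; apply: ler_sum => i _ /=.
    have := w4_0 i; have := w5_0 i; rewrite !mxE => *; rewrite ler_norml; lra.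
  have le67 : (th^T *m (w6 - w7)) 0 0 <= l1norm th * ((1 - alpha) * w3).
    rewrite mulmx11_sum mulr_suml; apply: ler_sum => i _.
    apply: le_trans (ler_norm _) _; rewrite normrM ler_wpM2l //.
    have := w6_0 i; have := w7_0 i; have := w67 i; rewrite !mxE => *.
    rewrite ler_norml; lra.
  apply: (@le_trans _ _ ((alpha * linfnorm th + (1 - alpha) * l1norm th) * w3)).
    have -> : - (th^T *m h) 0 0 =
      (th^T *m (w5 - w4)) 0 0 + (th^T *m (w6 - w7)) 0 0.
      rewrite /h !mulmxDr !mulmxN !(mxE _ _ 0 0); ring.
    by apply: le_trans (lerD le45 le67) _; rewrite le_eqVlt; apply/orP; left;
      apply/eqP; ring.
  by rewrite ler_wpM2r.
lra.
Qed.

Lemma optimal_pair_optimal (x t : 'cV[R]_n) (xi : R) (v : 'cV[R]_q)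
    (w1 w2 : 'cV[R]_n) (w3 : R) (w4 w5 w6 w7 : 'cV[R]_q) :
  optimal_pair x t xi v w1 w2 w3 w4 w5 w6 w7 -> optimalP A M y tau alpha x.
Proof.
move=> [/matM1P[pr du]]; rewrite matM2E -[X in _ = X -> _]col_mx0.
set h := w4 - w5 - w6 + w7 => /eq_col_mx[Ah gap].
split=> [|z /dual_le_l1norm/(_ du)]; first exact: feasibleP_primal pr.
rewrite -/h => /(_ (subr0_eq Ah)) le_z.
have := congr1 (fun C : 'M_1 => C 0 0) gap.
rewrite mxE [RHS]mxE eqxx mulr1n => gap0.
apply: (@le_trans _ _ (\sum_i t i 0)); last by lra.
by case: pr => le_t _ _ _; apply: ler_sum.
Qed.

(* The signs of [t], [xi], [v] are left free, and the rows dual to [w4] and [w5]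
   are ordered so that their signs are those of [matM2]. *)
Definition lp_matrix :
    'M[R]_(n + (n + (1 + (q + (q + (q + q))))), n + (n + (1 + q))) :=
  col_mx (row_mx 1%:M (row_mx (- 1%:M) (row_mx 0 0))) (
  col_mx (row_mx (- 1%:M) (row_mx (- 1%:M) (row_mx 0 0))) (
  col_mx (row_mx 0 (row_mx 0 (row_mx alpha%:M (const_mx (1 - alpha))))) (
  col_mx (row_mx (- (M^T *m A)) (row_mx 0 (row_mx (const_mx (-1)) 0))) (
  col_mx (row_mx (M^T *m A) (row_mx 0 (row_mx (const_mx (-1)) 0))) (
  col_mx (row_mx (M^T *m A) (row_mx 0 (row_mx 0 (- 1%:M))))
         (row_mx (- (M^T *m A)) (row_mx 0 (row_mx 0 (- 1%:M))))))))).

Definition lp_rhs : 'cV[R]_(n + (n + (1 + (q + (q + (q + q)))))) :=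
  col_mx 0 (col_mx 0 (col_mx tau%:M (col_mx (- (M^T *m y)) (col_mx (M^T *m y)
  (col_mx (M^T *m y) (- (M^T *m y))))))).

Definition lp_cost : 'rV[R]_(n + (n + (1 + q))) :=
  row_mx 0 (row_mx (const_mx 1) (row_mx 0 0)).

Lemma lp_matrixP x t xi v :
  lev (lp_matrix *m col_mx x (col_mx t (col_mx (xi%:M : 'cV_1) v))) lp_rhs <->
  primal_ineqs tau x t xi v.
Proof.
set u := col_mx x _.
have thetaE i : residual A M y x i 0 = (M^T *m A *m x) i 0 - (M^T *m y) i 0.
  by rewrite /residual mulmxBr mulmxA mxE [X in _ + X]mxE.
set theta := residual A M y x in thetaE *.
have -> : primal_ineqs tau x t xi v <->
  ((forall i, x i 0 <= t i 0) /\ ((forall i, - x i 0 <= t i 0) /\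
  (alpha * xi + (1 - alpha) * (\sum_i v i 0) <= tau /\
  ((forall i, - theta i 0 <= xi) /\ ((forall i, theta i 0 <= xi) /\
  ((forall i, theta i 0 <= v i 0) /\ (forall i, - theta i 0 <= v i 0))))))).
  rewrite /primal_ineqs -/theta.
  split=> [[/forall_norm_le[? ?] ? /forall_norm_le[? ?] /forall_norm_le[? ?]]
    //|].
  by move=> [h1] [h2] [?] [?] [?] [? ?]; split=> //; apply/forall_norm_le.
rewrite /lp_matrix /lp_rhs.
do 6 ?apply: lev_col_mulmx; rewrite {}/u !mul_row_col ?mul_mx_scalar.
all: rewrite ?(mul0mx, scaler0, add0r, addr0, mulNmx, mul1mx).
- by split=> h i; have := h i; rewrite !mxE subr_le0.
- by split=> h i; have := h i; rewrite !mxE subr_le0.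
- have entry11 (P : 'I_1 -> Prop) : (forall i, P i) <-> P 0.
    by split=> // P0 i; rewrite (ord1 i).
  rewrite /lev entry11 !(mxE _ _ 0 0) eqxx mulrC mulr_sumr.
  by under eq_bigr do rewrite mxE.
- split=> h i; have := h i; rewrite thetaE !(mxE _ _ i 0); lra.
- split=> h i; have := h i; rewrite thetaE !(mxE _ _ i 0); lra.
- split=> h i; have := h i; rewrite thetaE !(mxE _ _ i 0); lra.
- split=> h i; have := h i; rewrite thetaE !(mxE _ _ i 0); lra.
Qed.

Lemma lp_dualE (w1 w2 : 'rV[R]_n) (w3 : R) (w4 w5 w6 w7 : 'rV[R]_q) :
  row_mx w1 (row_mx w2 (row_mx (w3%:M : 'M_1) (row_mx w4 (row_mx w5
    (row_mx w6 w7))))) *m lp_matrix =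
  row_mx (w1 - w2 - (w4 - w5 - w6 + w7) *m (M^T *m A))
    (row_mx (- (w1 + w2))
      (row_mx (w3 * alpha - (\sum_i w4 0 i + \sum_i w5 0 i))%:M
              (w3 *: const_mx (1 - alpha) - (w6 + w7)))).
Proof.
have sumE (w : 'rV[R]_q) : w *m const_mx (-1) = (- \sum_i w 0 i)%:M :> 'M_1.
  apply/matrixP=> i j; rewrite !ord1 [LHS]mxE [RHS]mxE eqxx mulr1n -sumrN.
  by apply: eq_bigr => k _; rewrite mxE mulrN1.
rewrite /lp_matrix !mul_row_col !mul_mx_row !add_row_mx !mulmx0 !add0r !addr0.
rewrite !mulmxN !mulmx1 !sumE !mul_scalar_mx scale_scalar_mx.
congr (row_mx _ (row_mx _ (row_mx _ _))).
- rewrite mulmxDl !mulmxBl.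
  move: (w4 *m _) (w5 *m _) (w6 *m _) (w7 *m _) => a4 a5 a6 a7.
  apply/matrixP=> i j; rewrite !mxE.
  by move: (w1 i j) (w2 i j) (a4 i j) (a5 i j) (a6 i j) (a7 i j) => *; ring.
- by rewrite opprD.
- by rewrite opprD !raddfD.
- by rewrite opprD.
Qed.

(** Strong duality applies since both programs have explicit feasible points: a solution of
    [A x = y], whose residual is 0, and [w1 = w2 = 1/2] with all other multipliers 0. *)
Lemma exists_optimal_pair : (exists x, A *m x = y) ->
  exists x t xi v w1 w2 w3 w4 w5 w6 w7,
    optimal_pair x t xi v w1 w2 w3 w4 w5 w6 w7.
Proof.
move=> [x0 Ax0].
have [|||u [w [Bu w_ge0 wB gap]]] := @lp_strong_duality R _ _ lp_matrix lp_rhs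
  lp_cost (col_mx x0 (col_mx (\col_i `|x0 i 0|) (col_mx ((0 : R)%:M : 'cV_1)
    0)))
  (row_mx (const_mx 2^-1) (row_mx (const_mx 2^-1) (row_mx ((0 : R)%:M : 'M_1)
    (row_mx 0 (row_mx 0 (row_mx 0 0)))))).
- have res0 : residual A M y x0 = 0 by rewrite /residual Ax0 subrr mulmx0.
  apply/lp_matrixP; split=> [i||i|i]; rewrite ?res0 ?mxE ?normr0 //.
  by rewrite big1 ?mulr0 ?addr0 // => i _; rewrite mxE.
- do 6![apply/row_mx_ge0; split; first
    by move=> i; rewrite !mxE ?mul0rn ?invr_ge0 ?ler0n ?lexx].
  by move=> i; rewrite mxE lexx.
- rewrite lp_dualE /lp_cost !opp_row_mx !subrr !addr0 sub0r mul0mx.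
  rewrite big1 => [|i _]; last by rewrite mxE.
  rewrite mul0r addr0 subrr scale0r sub0r raddf0.
  rewrite !oppr0 (raddf0 (@scalar_mx R 1)); congr (row_mx _ (row_mx (- _) _)).
  by apply/matrixP=> i j; rewrite !mxE; lra.
move: Bu wB gap w_ge0; rewrite -(vsubmxK u) -(vsubmxK (dsubmx u)).
rewrite -(vsubmxK (dsubmx (dsubmx u))) (mx11_scalar (usubmx (dsubmx (dsubmx
  u)))).
move: (usubmx u) (usubmx (dsubmx u)) (_ 0 0) (dsubmx (dsubmx (dsubmx u))).
move=> x t xi v; rewrite -(hsubmxK w).
set w1 := lsubmx w; set r1 := rsubmx w; rewrite -(hsubmxK r1).
set w2 := lsubmx r1; set r2 := rsubmx r1; rewrite -(hsubmxK r2).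
rewrite (mx11_scalar (lsubmx r2)).
set w3 := lsubmx r2 0 0; set r3 := rsubmx r2; rewrite -(hsubmxK r3).
set w4 := lsubmx r3; set r4 := rsubmx r3; rewrite -(hsubmxK r4).
set w5 := lsubmx r4; set r5 := rsubmx r4; rewrite -(hsubmxK r5).
set w6 := lsubmx r5; set w7 := rsubmx r5.
move: w1 w2 w3 w4 w5 w6 w7 => w1 w2 w3 w4 w5 w6 w7.
move=> /lp_matrixP pr; rewrite lp_dualE /lp_cost !opp_row_mx.
move=> /eq_row_mx[wx /eq_row_mx[wt /eq_row_mx[wxi wv]]].
rewrite !mul_row_col => gap.
move=> /row_mx_ge0[w1_ge0 /row_mx_ge0[w2_ge0 /row_mx_ge0[w3_ge0]]].
move=> /row_mx_ge0[w4_ge0 /row_mx_ge0[w5_ge0 /row_mx_ge0[w6_ge0 w7_ge0]]].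
exists x, t, xi, v, w1^T, w2^T, w3, w4^T, w5^T, w6^T, w7^T.
set h := w4^T - w5^T - w6^T + w7^T.
have hE : (w4 - w5 - w6 + w7)^T = h by apply/matrixP=> i j; rewrite !mxE.
have ge0_tr k (a : 'rV[R]_k) : (forall i, 0 <= a 0 i) -> lev 0 a^T.
  by move=> a_ge0 i; rewrite !mxE.
have tr_sum (a : 'rV[R]_q) : \sum_i a^T i 0 = \sum_i a 0 i.
  by apply: eq_bigr => i _; rewrite mxE.
have du : dual_ineqs w1^T w2^T w3 w4^T w5^T w6^T w7^T.
  split; last first.
  - split; split; try exact: ge0_tr.
    by have := w3_ge0 0; rewrite mxE eqxx.
  - move=> i; have := congr1 (fun C : 'rV_q => C 0 i) wv; rewrite !mxE; lra.
  - have := congr1 (fun C : 'M_1 => C 0 0) wxi;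
      rewrite !tr_sum !mxE eqxx mulr1n.
    lra.
  - move=> i; have := congr1 (fun C : 'rV_n => C 0 i) wt; rewrite !mxE; lra.
have Ah : A^T *m (M *m h) = w1^T - w2^T.
  apply: trmx_inj; rewrite -hE !trmx_mul !trmxK linearB /= !trmxK -mulmxA.
  by apply/esym/eqP; rewrite -subr_eq0 wx oppr0.
have yh : (y^T *m (M *m h)) 0 0 = ((w4 - w5 - w6 + w7) *m (M^T *m y)) 0 0.
  by rewrite [RHS]mulmx11_tr !trmx_mul trmxK hE -mulmxA.
have {}gap : \sum_i t i 0 + tau * w3 - (y^T *m (M *m h)) 0 0 <= 0.
  move: gap; rewrite yh !mul0mx !mulmx0 !add0r !addr0 !mulmxDl !mulNmx !mulmxN.
  have -> : ((const_mx 1 : 'rV[R]_n) *m t) 0 0 = \sum_i t i 0.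
    by rewrite mxE; apply: eq_bigr => i _; rewrite mxE mul1r.
  rewrite mul_scalar_mx scale_scalar_mx.
  move: (w4 *m _) (w5 *m _) (w6 *m _) (w7 *m _) => a4 a5 a6 a7.
  rewrite !mxE eqxx mulr1n.
  by move: (a4 0 0) (a5 0 0) (a6 0 0) (a7 0 0) => *; lra.
split; first by apply/matM1P.
rewrite matM2E -/h Ah subrr.
(* Strong duality bounds the gap above by 0; the equality demanded by [matM2] needs weak duality as
   well. *)
suff -> : \sum_i t i 0 + tau * w3 - (y^T *m (M *m h)) 0 0 = 0.
  by rewrite raddf0 col_mx0.
apply/le_anti; rewrite gap /= subr_ge0 -lerBlDr.
apply: le_trans (dual_le_l1norm (feasibleP_primal pr) du Ah) _.
by case: pr => le_t _ _ _; apply: ler_sum.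
Qed.

End OptimalityPolyhedron.

(** * Multipliers with l1 norm bounded by [const_c] *)

Section ConstantC.
Context {R : realType}.

Lemma norm_inf_to_1_ge p r (Q : 'M[R]_(p, r)) (x : 'cV[R]_r) :
  linfnorm x <= 1 -> l1norm (Q *m x) <= norm_inf_to_1 Q.
Proof.
move=> x1; apply: ub_le_sup; last by exists x.
exists (\sum_i \sum_j `|Q i j|) => _ [z /= z1 <-].
apply: ler_sum => i _; rewrite mxE; apply: le_trans (ler_norm_sum _ _ _) _.
apply: ler_sum => j _; rewrite normrM ler_piMr //.
exact: le_trans (normr_le_linfnorm z j) z1.
Qed.

Lemma gram_unitmx m n (A : 'M[R]_(m, n)) : \rank A = m -> A *m A^T \in unitmx.
Proof.
move=> rankA; rewrite -row_free_unit -kermx_eq0.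
apply/eqP/row_matrixP=> i; rewrite row0; set u := row i _.
have u0 : u *m (A *m A^T) = 0 by rewrite -row_mul mulmx_ker row0.
have uA : u *m A = 0.
  apply: trmx_inj; rewrite trmx0; apply: sqnorm_eq0.
  by rewrite /sqnorm trmxK trmx_mul mulmxA -(mulmxA u) u0 mul0mx mxE.
by apply: (@row_free_inj _ _ _ _ A); rewrite ?mul0mx // /row_free rankA.
Qed.

Lemma row_free_solve m n (A : 'M[R]_(m, n)) (y : 'cV[R]_m) :
  \rank A = m -> exists x, A *m x = y.
Proof.
move=> rankA; have : (y^T <= A^T)%MS.
  by apply: submx_full; rewrite /row_full mxrank_tr rankA.
by case/submxP=> D yD; exists D^T; apply: trmx_inj; rewrite trmx_mul trmxK.
Qed.

Variables (m n q : nat) (A : 'M[R]_(m, n)) (M : 'M[R]_(m, q)).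

(** The set of values is indexed by [G] together with a proof of its cardinality. By irrelevance of
    these proofs there is one value for each [G], so finitely many, and the supremum is over a
    bounded set. *)
Lemma const_c_ge (G : {set 'I_q}) (cardG : #|G| = m) :
  col_submx M cardG \in unitmx ->
  norm_inf_to_1 (invmx (col_submx M cardG) *m invmx (A *m A^T) *m A) <=
  const_c A M.
Proof.
pose f (H : {set 'I_q}) (cardH : #|H| = m) :=
  norm_inf_to_1 (invmx (col_submx M cardH) *m invmx (A *m A^T) *m A).
move=> unitG; apply: ub_le_sup; last by exists G, cardG.
have /choice[b bP] (H : {set 'I_q}) : exists c, forall cardH, f H cardH <= c.
  have [cardH|] := pselect (#|H| = m); last by exists 0.
  by exists (f H cardH) => cardH'; rewrite (eq_irrelevance cardH cardH').
exists (\sum_H `|b H|) => _ [H [cardH [_ ->]]].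
apply: le_trans (bP H cardH) (le_trans (ler_norm _) _).
by rewrite (bigD1 H) //= lerDl sumr_ge0.
Qed.

(** Extend [v] by zeros outside [G]. *)
Lemma col_submxE (G : {set 'I_q}) (cardG : #|G| = m) (v : 'cV[R]_m) :
  exists h : 'cV[R]_q, M *m h = col_submx M cardG *m v /\ l1norm h <= l1norm v.
Proof.
rewrite /col_submx; case: m / cardG M v => M' v; rewrite castmx_id.
pose E : 'M[R]_(q, #|G|) := \matrix_(j, i) (enum_val i == j)%:R.
exists (E *m v); split.
  rewrite mulmxA; congr (_ *m _); apply/matrixP=> i j; rewrite !mxE.
  rewrite (bigD1 (enum_val j)) //= mxE eqxx mulr1 big1 ?addr0 // => k kj.
  by rewrite mxE eq_sym (negPf kj) mulr0.
apply: (@le_trans _ _ (\sum_j \sum_i (enum_val i == j)%:R * `|v i 0|)).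
  apply: ler_sum => j _; rewrite mxE; apply: le_trans (ler_norm_sum _ _ _) _.
  by apply: ler_sum => i _; rewrite mxE normrM normr_nat.
rewrite exchange_big /=; apply: ler_sum => i _.
rewrite (bigD1 (enum_val i)) //= eqxx mul1r big1 ?addr0 // => j ij.
by rewrite eq_sym (negPf ij) mul0r.
Qed.

Hypotheses (rankA : \rank A = m) (rankM : \rank M = m).

Lemma exists_unit_col_submx :
  exists (G : {set 'I_q}) (cardG : #|G| = m), col_submx M cardG \in unitmx.
Proof.
have full : row_full M^T by rewrite /row_full mxrank_tr rankM.
pose f := fullrankfun full; pose G : {set 'I_q} := f @: 'I_m.
have cardG : #|G| = m by rewrite card_imset ?card_ord //;
  exact: fullrankfun_inj.
(* [f] need not enumerate [G] in the order of [enum_val], so invertibility is proved by comparing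
   row spaces: each chosen row of [M^T] occurs in the transposed submatrix. *)
exists G, cardG; rewrite -unitmx_tr -row_full_unit -sub1mx.
have := fullrowsub_full full; rewrite -sub1mx => /submx_trans; apply.
apply/row_subP=> i.
have fi : f i \in G by apply/imsetP; exists i.
pose j := cast_ord cardG (enum_rank_in fi (f i)).
suff -> : row i (rowsub f M^T) = row j (col_submx M cardG)^T by exact: row_sub.
apply/rowP=> k; rewrite !mxE castmxE !mxE /=; congr (M _ _).
  by apply: val_inj.
by rewrite cast_ordK enum_rankK_in.
Qed.

(** Take [h] supported on [G] with values [M_G^-1 u]. As [u = (A A^T)^-1 A (A^T u)], these values
    are the matrix of [const_c] applied to the vector [A^T u] of the unit ball. *)
Lemma exists_multiplier (u : 'cV[R]_m) : linfnorm (A^T *m u) <= 1 ->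
  exists h : 'cV[R]_q, M *m h = u /\ l1norm h <= const_c A M.
Proof.
move=> u1; have [G [cardG unitG]] := exists_unit_col_submx.
have [h [Mh le_h]] := col_submxE cardG (invmx (col_submx M cardG) *m u).
exists h; rewrite Mh mulKVmx //; split=> //; apply: le_trans le_h _.
apply: le_trans (const_c_ge unitG).
have -> : invmx (col_submx M cardG) *m u =
    invmx (col_submx M cardG) *m invmx (A *m A^T) *m A *m (A^T *m u).
  by rewrite -!mulmxA (mulmxA A) mulKmx // gram_unitmx.
exact: norm_inf_to_1_ge.
Qed.

End ConstantC.

(** * Completion of [x] to a primal-dual point and the final estimate *)

Section ErrorBound.
Context {R : realType}.

(** Among the sets of at most [k] indices take one with the smallest tail. The support of any
    admissible [u] is such a set, and [x - u] agrees with [x] outside it. *)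
Lemma sigma1_attained k n (x : 'cV[R]_n) :
  exists2 S : {set 'I_n}, (#|S| <= k)%N &
    \sum_(i | i \notin S) `|x i 0| <= sigma1 k x.
Proof.
have S0 : (#|finset.set0 : {set 'I_n}| <= k)%N by rewrite cards0.
case: (@arg_minP _ _ _ _ (fun S : {set 'I_n} => #|S| <= k)%N
  (fun S => \sum_(i | i \notin S) `|x i 0|) S0) => S Sk Smin.
exists S => //; apply: lb_le_inf.
  exists (l1norm (x - 0)), 0 => //=; rewrite /l0norm.
  by rewrite (_ : [set i | _]%SET = finset.set0) ?cards0 //; apply/setP=> i;
    rewrite !inE mxE eqxx.
move=> _ [u /= uk <-]; apply: le_trans (Smin _ uk) _.
rewrite [leRHS](bigID (fun i => u i 0 == 0)) /= -[leLHS]addr0 lerD ?sumr_ge0 //.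
rewrite le_eqVlt; apply/orP; left; apply/eqP; apply: eq_big => i.
  by rewrite inE negbK.
by rewrite inE negbK => /eqP ui; rewrite !mxE ui subr0.
Qed.

Variables (m n q k : nat) (A : 'M[R]_(m, n)) (M : 'M[R]_(m, q)) (y : 'cV[R]_m).
Variables (tau alpha : R).
Hypotheses (rankA : \rank A = m) (rankM : \rank M = m).
Hypotheses (tau_ge0 : 0 <= tau) (alpha01 : 0 <= alpha <= 1).
Hypothesis rspA : weak_RSP A^T k.

(** With [zeta] equal to the sign of [x] on the nonzero entries in [S], the terms
    [|x_i| - x_i zeta_i] vanish on [S] and are at most [2 |x_i|] elsewhere. *)
Lemma rsp_multiplier x : exists h : 'cV[R]_q,
  [/\ l1norm h <= const_c A M, linfnorm (A^T *m (M *m h)) <= 1 &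
      l1norm x - (x^T *m (A^T *m (M *m h))) 0 0 <= 2 * sigma1 k x].
Proof.
have [S Sk leS] := sigma1_attained k x.
pose S1 := [set i in S | 0 < x i 0]; pose S2 := [set i in S | x i 0 < 0].
have [||zeta [[u zetaE] z1 z2 z3]] := rspA (S1 := S1) (S2 := S2).
- rewrite -setI_eq0; apply/eqP/setP=> i; rewrite !inE.
  by apply/negP=> /andP[/andP[_ xi] /andP[_ /(lt_trans xi)]]; rewrite ltxx.
- apply: leq_trans Sk; rewrite -cardsUI (_ : S1 :&: S2 =
    finset.set0) ?cards0 ?addn0.
    by apply: subset_leq_card; apply/fintype.subsetP=> i;
      rewrite !inE -andb_orr => /andP[].
  apply/setP=> i; rewrite !inE.
  by apply/negP=> /andP[/andP[_ xi] /andP[_ /(lt_trans xi)]]; rewrite ltxx.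
have zeta_le1 i : `|zeta i 0| <= 1.
  have [/z1 ->|nS1] := boolP (i \in S1); first by rewrite normr1.
  have [/z2 ->|nS2] := boolP (i \in S2); first by rewrite normrN1.
  by apply: z3; rewrite finset.inE negb_or nS1.
have [|h [Mh le_h]] := exists_multiplier rankA rankM (u := u).
  by rewrite -zetaE; apply: linfnorm_le.
exists h; rewrite Mh -zetaE; split=> //; first exact: linfnorm_le.
apply: (@le_trans _ _ (2 * \sum_(i | i \notin S) `|x i 0|));
  last by rewrite ler_pM2l.
rewrite mulmx11_sum /l1norm -sumrB (bigID (fun i => i \in S)) /=.
rewrite big1 ?add0r => [|i iS].
  rewrite mulr_sumr; apply: ler_sum => i _.
  have : - (x i 0 * zeta i 0) <= `|x i 0|.
    by rewrite -mulrN; apply: le_trans (ler_norm _) _;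
      rewrite normrM normrN ler_piMr.
  lra.
have [xi|xi|xi] := ltrgtP (x i 0) 0.
- by rewrite z2 ?inE ?iS // ltr0_norm // mulrN1 subrr.
- by rewrite z1 ?inE ?iS // gtr0_norm // mulr1 subrr.
- by rewrite xi normr0 mul0r subrr.
Qed.

Lemma error_bound x : exists xs, optimalP A M y tau alpha xs /\
  l2norm (x - xs) <= const_gamma A M y tau alpha *
    (pos_part (alpha * linfnorm (residual A M y x)
               + (1 - alpha) * l1norm (residual A M y x) - tau)
     + 2 * sigma1 k x + const_c A M * (tau + linfnorm (residual A M y x))).
Proof.
case/andP: (alpha01) => a0 a1.
set th := residual A M y x; set s := pos_part _.
have s_ge0 : 0 <= s by rewrite /s /pos_part le_max lexx orbT.
have [h [h_c z_le1 gap_x]] := rsp_multiplier x.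
have [zeta zetaE] : exists z, z = A^T *m (M *m h) by eexists.
rewrite -zetaE in z_le1 gap_x.
pose hp : 'cV[R]_q := \col_i Num.max (h i 0) 0.
pose hm : 'cV[R]_q := \col_i Num.max (- h i 0) 0.
pose zp : 'cV[R]_n := \col_i Num.max (zeta i 0) 0.
pose zm : 'cV[R]_n := \col_i Num.max (- zeta i 0) 0.
have maxE (a : R) : [/\ Num.max a 0 - Num.max (- a) 0 = a,
    Num.max a 0 + Num.max (- a) 0 = `|a|, 0 <= Num.max a 0 &
      0 <= Num.max (- a) 0].
  case: (lerP a 0) => a_0.
    by rewrite (max_idPl _) ?oppr_ge0 // opprK !add0r ler0_norm // oppr_ge0
      lexx.
  have Na : - a <= 0 by rewrite oppr_le0 ltW.
  by rewrite (max_idPr Na) subr0 addr0 gtr0_norm // lexx ltW.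
pose w3 := l1norm h.
(* Write [h = alpha h + (1 - alpha) h]. The first share goes to [w4 - w5], making their row tight at
   [alpha * w3]; the second goes to [w7 - w6], whose signs in [matM2] are opposite, and fits because
   each entry of [h] is at most [l1norm h]. *)
pose z0 := pd_point x (\col_i `|x i 0|) (linfnorm th) (\col_i `|th i 0|)
  zp zm w3 (alpha *: hp) (alpha *: hm) ((1 - alpha) *: hm) ((1 - alpha) *: hp).
have w_h : alpha *: hp - alpha *: hm - (1 - alpha) *: hm + (1 - alpha) *: hp =
  h.
  apply/matrixP=> i j; rewrite (ord1 j) !mxE.
  have [E _ _ _] := maxE (h i 0); rewrite -[RHS]E.
  by move: (Num.max _ 0) (Num.max _ 0) => *; ring.
have z_zeta : zp - zm = zeta.
  by apply/matrixP=> i j; rewrite (ord1 j) !mxE;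
    have [-> _ _ _] := maxE (zeta i 0).
have pr : primal_ineqs A M y alpha (tau + s) x (\col_i `|x i 0|) (linfnorm th)
    (\col_i `|th i 0|).
  split=> [i||i|i]; [by rewrite mxE| |exact: normr_le_linfnorm|by rewrite
    [leRHS]mxE].
  rewrite -lerBlDl /s /pos_part le_max; apply/orP; left.
  by rewrite /l1norm; under eq_bigr do rewrite mxE.
have du : dual_ineqs alpha zp zm w3 (alpha *: hp) (alpha *: hm)
    ((1 - alpha) *: hm) ((1 - alpha) *: hp).
  have a1_0 : 0 <= 1 - alpha by rewrite subr_ge0.
  split.
  - move=> i; rewrite !mxE; have [_ -> _ _] := maxE (zeta i 0).
    exact: le_trans (normr_le_linfnorm _ _) z_le1.
  - rewrite -big_split /w3 /l1norm mulr_sumr; apply: ler_sum => i _ /=.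
    rewrite !mxE -mulrDr.
    by have [_ -> _ _] := maxE (h i 0).
  - move=> i; rewrite !mxE -mulrDr [Num.max _ _ + _]addrC;
      have [_ -> _ _] := maxE (h i 0).
    by rewrite ler_wpM2l // /w3 /l1norm (bigD1 i) //= lerDl sumr_ge0.
  - split; split; try (by move=> i; rewrite !mxE ?mulr_ge0 //;
      try (by have [_ _ ? ?] := maxE (h i 0));
        have [_ _ ? ?] := maxE (zeta i 0)).
    exact: l1norm_ge0.
have M1z0 : lev (matM1 A M alpha *m z0) (pd_rhs n M y (tau + s)) by
  apply/matM1P.
pose d1 := pd_rhs n M y (tau + s) - pd_rhs n M y tau.
pose d2 := matM2 A M y tau *m z0.
have d1E : d1 = col_mx 0 (col_mx 0 (col_mx s%:M 0)).
  rewrite /d1 /pd_rhs !opp_col_mx !add_col_mx !subrr -raddfB /= addrC addKr.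
  by rewrite !col_mx0.
have M2z0 : matM2 A M y tau *m z0 = 0 + d2 by rewrite add0r.
have d1_ge0 : lev 0 d1.
  rewrite d1E -!col_mx0; do 3![apply/lev_col_mx; split; first
    by move=> i; rewrite !mxE ?mulrn_wge0 ?lexx].
  exact: lev_refl.
(* By [dual_value] the gap is [(l1norm x - x^T zeta) + tau * w3 + th^T h], and the three terms are
   bounded separately. *)
have d2_le : l1norm d2 <= 2 * sigma1 k x + const_c A M * (tau + linfnorm th).
  rewrite /d2 matM2E w_h -zetaE z_zeta subrr l1norm_col_mx l1norm0 add0r.
  rewrite l1norm_scalar (dual_value A M y x) -zetaE -/th.
  under eq_bigr do rewrite mxE.
  rewrite -[\sum_i _]/(l1norm x).
  have th_h : `|(th^T *m h) 0 0| <= linfnorm th * const_c A M.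
    apply: le_trans (ler_norm_mulmx11 _ _) _.
    by rewrite ler_wpM2l ?linfnorm_ge0.
  have gap_ge0 : 0 <= l1norm x - (x^T *m zeta) 0 0.
    rewrite subr_ge0 mulmx11_tr trmxK; apply: le_trans (ler_norm _) _.
    apply: le_trans (ler_norm_mulmx11 _ _) _.
    by rewrite ler_piMl ?l1norm_ge0.
  have tau_w3 : tau * w3 <= tau * const_c A M by rewrite ler_wpM2l.
  have tau_w3_ge0 : 0 <= tau * w3 by rewrite mulr_ge0 ?l1norm_ge0.
  move: th_h; rewrite !ler_norml => /andP[th_h1 th_h2]; apply/andP; split; lra.
have {}M1z0 : lev (matM1 A M alpha *m z0) (pd_rhs n M y tau + d1).
  by rewrite /d1 addrC subrK.
have [|z [N1z N2z le_z]] := robinson_bound _ d1_ge0 M1z0 M2z0.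
  have [x0 [t0 [xi0 [v0 [u1 [u2 [u3 [u4 [u5 [u6 [u7 opt]]]]]]]]]]] :=
    exists_optimal_pair M tau_ge0 alpha01 (row_free_solve y rankA).
  by exists (pd_point x0 t0 xi0 v0 u1 u2 u3 u4 u5 u6 u7).
have [xs [t [xi [v [u1 [u2 [u3 [u4 [u5 [u6 [u7 zE]]]]]]]]]]] := pd_pointP z.
rewrite {}zE in N1z N2z le_z; exists xs; split.
  exact: (optimal_pair_optimal tau_ge0 alpha01 (conj N1z N2z)).
set z1 := pd_point xs _ _ _ _ _ _ _ _ _ _ in le_z.
have -> : x - xs = usubmx (z0 - z1) by rewrite linearB /= !col_mxKu.
apply: le_trans (l2norm_usubmx _) (le_trans le_z _).
rewrite -addrA ler_wpM2l ?robinson_sigma_ge0 // lerD // d1E.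
by rewrite !l1norm_col_mx !l1norm0 l1norm_scalar !add0r addr0 ger0_norm.
Qed.

End ErrorBound.

Theorem theorem3p2 (R : realType) (m n q k : nat)
    (A : 'M[R]_(m, n)) (M : 'M[R]_(m, q)) (y : 'cV[R]_m) (tau alpha : R)
    (lt_mn : (m < n)%N) (le_mq : (m <= q)%N)
    (rankA : \rank A = m) (rankM : \rank M = m)
    (tau_ge0 : 0 <= tau) (alpha01 : 0 <= alpha <= 1)
    (rspA : weak_RSP A^T k) :
  let c := const_c A M in
  let gamma := const_gamma A M y tau alpha in
  let theta := residual A M y in
  (forall x : 'cV[R]_n,
     exists xs : 'cV[R]_n, optimalP A M y tau alpha xs /\
       l2norm (x - xs) <=
         gamma * (pos_part (alpha * linfnorm (theta x)
                            + (1 - alpha) * l1norm (theta x) - tau)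
                  + 2 * sigma1 k x + c * (tau + linfnorm (theta x))))
  /\
  (forall x : 'cV[R]_n, feasibleP A M y tau alpha x ->
     exists xs : 'cV[R]_n,
       [/\ optimalP A M y tau alpha xs,
           l2norm (x - xs) <=
             gamma * (2 * sigma1 k x + c * tau + c * linfnorm (theta x)) &
           gamma * (2 * sigma1 k x + c * tau + c * linfnorm (theta x)) <=
             2 * gamma * (sigma1 k x + c * tau)]).
Proof.
move=> c gamma theta.
have bound := error_bound y rankA rankM tau_ge0 alpha01 rspA.
split=> [x|x feas_x]; first exact: bound.
have [xs [opt le_xs]] := bound x; exists xs; split=> //.
  move: le_xs; rewrite -/(theta x) /pos_part (max_idPr _) ?subr_le0 //.
  by rewrite add0r [c * (_ + _)]mulrDr addrA.
(* [c] dominates the l1 norm of some multiplier. *)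
have c_ge0 : 0 <= c.
  have [h [le_c _ _]] := rsp_multiplier rankA rankM rspA x.
  exact: le_trans (l1norm_ge0 _) le_c.
(* As [linfnorm <= l1norm], the convex combination in the constraint is at least
   [linfnorm (theta x)]. *)
have theta_le : linfnorm (theta x) <= tau.
  case/andP: alpha01 => _ alpha_le1; apply: le_trans feas_x.
  rewrite -/(theta x) -lerBlDl -{1}[linfnorm _]mul1r -mulrBl.
  by rewrite ler_wpM2l ?subr_ge0 // linfnorm_le_l1norm.
rewrite [2 * gamma]mulrC -mulrA ler_wpM2l ?robinson_sigma_ge0 //.
by have := ler_wpM2l c_ge0 theta_le; lra.
Qed.
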